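(* Fix Hölder parameters $\alpha>\beta>0$ and constants $L(\alpha),L(\beta)>0$, and a noise level $\sigma>0$. Consider the dynamic pricing problem on $[p_{\min},1]$ with Gaussian demand $d_t\mid p_t=p \sim \mathcal N(f(p),\sigma^2)$. Suppose a policy $\pi$ (for each horizon $T$) satisfies $\sup_{f\in\mathcal H(\alpha,L(\alpha))}R^{\pi}(T)=\widetilde O\big(T^{\frac{\alpha+1}{2\alpha+1}}\big)$, i.e. it attains the optimal regret rate over $\mathcal H(\alpha,L(\alpha))$. Then there is a constant $C>0$ independent of $\pi$ such that, for all sufficiently large $T$, \[ \sup_{f\in\mathcal H(\beta,L(\beta))}R^{\pi}(T)\;\ge\; C\, T^{\frac{\beta+1}{2\beta+1}+\frac{\beta(\alpha-\beta)}{2(2\beta+1)^2(2\alpha+1)}} . \] In particular, $\pi$ cannot attain the rate $\widetilde O\big(T^{\frac{\beta+1}{2\beta+1}}\big)$ over $\mathcal H(\beta,L(\beta))$.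
   Context: Dynamic pricing model: fix $0<p_{\min}<1$. At each period $t=1,\dots,T$ a seller chooses a price $p_t\in[p_{\min},1]$ and observes a random demand $d_t$ with $\mathbb E[d_t\mid p_t=p]=f(p)$ for an unknown demand function $f$. An admissible policy $\pi$ is a sequence of (possibly randomized) maps $\pi_t:(p_1,d_1,\dots,p_{t-1},d_{t-1})\mapsto p_t$. With $p^*\in\arg\max_{p\in[p_{\min},1]}pf(p)$, the regret is $R^\pi(T)=\mathbb E^\pi\big[\sum_{t=1}^T (p^*f(p^* )-p_tf(p_t))\big]$. Hölder class: for $\beta>0$ let $w(\beta)$ be the largest integer strictly smaller than $\beta$. $\mathcal H_0(\beta,L)$ is the set of $w(\beta)$ times continuously differentiable $g:[p_{\min},1]\to\mathbb R$ with $\sup_p|g^{(k)}(p)|\le L$ for all $0\le k\le w(\beta)$ and $|g^{(w(\beta))}(p)-g^{(w(\beta))}(p')|\le L|p-p'|^{\beta-w(\beta)}$ for all $p,p'$. Set $\mathcal H(\beta,L)=\mathcal H_0(\beta,L)$ if $0<\beta<1$ and $\mathcal H(\beta,L)=\mathcal H_0(\beta,L)\cap\mathcal H_0(1,L)$ if $\beta\ge1$. $\widetilde O$ hides constants and polylogarithmic factors in $T$. *)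

(* Defs.v *)
From HB Require Import structures.
From mathcomp Require Import all_boot all_order all_algebra.
From mathcomp Require Import all_classical all_reals all_analysis.
Set Implicit Arguments.
Unset Strict Implicit.
Unset Printing Implicit Defensive.
Import Order.TTheory GRing.Theory Num.Theory.
Import numFieldNormedType.Exports.
Local Open Scope classical_set_scope.
Local Open Scope ring_scope.

Section pricing.
Variable R : realType.

(* w(beta) = largest integer strictly smaller than beta (beta > 0) *)
Definition wdeg (beta : R) : nat := absz (Num.ceil beta - 1).

Definition hoelder0 (pmin beta L : R) (f : R -> R) : Prop :=
  let w := wdeg beta in
  (forall k, (k < w)%N -> forall x, derivable (derive1n k f) x 1) /\
  continuous (derive1n w f) /\
  (forall k, (k <= w)%N -> forall p, p \in `[pmin, 1] ->
      `|derive1n k f p| <= L) /\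
  (forall p p', p \in `[pmin, 1] -> p' \in `[pmin, 1] ->
      `|derive1n w f p - derive1n w f p'| <= L * powR `|p - p'| (beta - w%:R)).

Definition hoelder (pmin beta L : R) (f : R -> R) : Prop :=
  hoelder0 pmin beta L f /\ (1 <= beta -> hoelder0 pmin 1 L f).

(* ---------- histories (p_1,d_1,...,p_n,d_n), n >= 1 ---------- *)
(* hist n is the history of length n.+1, as a measurable space *)
Fixpoint histS (n : nat) : {d : measure_display & measurableType d} :=
  match n with
  | 0 => existT (fun d => measurableType d) _ ((R * R)%type : measurableType _)
  | n.+1 => existT (fun d => measurableType d) _
      ((projT2 (histS n) * (R * R))%type : measurableType _)
  end.
Definition hist (n : nat) : measurableType (projT1 (histS n)) := projT2 (histS n).

(* An admissible (randomized) pricing policy: the first price is drawn from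
   a probability measure, the (n+2)-th price from a probability kernel
   applied to the history of the first n+1 rounds; all prices lie in
   [pmin, 1] almost surely. *)
Record policy (pmin : R) := Policy {
  pol_first : probability R R ;
  pol_next : forall n : nat, R.-pker (hist n) ~> R ;
  pol_first_supp : pol_first `[pmin, 1]%classic = 1%E ;
  pol_next_supp : forall n (h : hist n), pol_next n h `[pmin, 1]%classic = 1%E }.

Definition gap (pmin : R) (f : R -> R) (p : R) : R :=
  sup [set q * f q | q in `[pmin, 1]%classic] - p * f p.

(* expected regret of the remaining m rounds, given a history of length n+1,
   with Gaussian demand d ~ N(f(p), sigma^2) *)
Fixpoint regret_rest (pmin sigma : R) (f : R -> R) (pi : policy pmin)
   (m n : nat) {struct m} : hist n -> \bar R :=
  match m with
  | 0 => fun _ => 0%E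
  | m'.+1 => fun h =>
      (\int[pol_next pi n h]_p
         ((gap pmin f p)%:E +
          \int[normal_prob (f p) sigma]_d
             @regret_rest pmin sigma f pi m' n.+1 ((h, (p, d)) : hist n.+1)))%E
  end.

Definition regret (pmin sigma : R) (f : R -> R) (pi : policy pmin) (T : nat)
  : \bar R :=
  match T with
  | 0 => 0%E
  | T'.+1 =>
      (\int[pol_first pi]_p
         ((gap pmin f p)%:E +
          \int[normal_prob (f p) sigma]_d
             @regret_rest pmin sigma f pi T' 0 ((p, d) : hist 0)))%E
  end.

Definition sup_regret (pmin sigma beta L : R) (pi : policy pmin) (T : nat)
  : \bar R :=
  ereal_sup [set regret sigma f pi T | f in [set f | hoelder pmin beta L f]].

End pricing.

(* Main.v *)
(* Take the polynomial demand [f0 = c * sum_(i < n) (1 - p)^i]: its revenue is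
   [c (1 - (1 - p)^n)], flat to order [n] at the optimal price [1], and it lies in
   every Hoelder class for small [c]. Cut [1 - 2u, 1 - u] into [M] bins. Each
   price in a bin costs at least [D = c u^n] under [f0], so the regret bound on
   the [alpha]-class makes the policy visit some bin only rarely. Adding to [f0]
   a bump of height [~ u^n] in that bin gives a [beta]-smooth demand under which
   every price outside the bin costs at least [D]; the policy does not collect
   enough information to distinguish the two demands, and pays [~ T u^n]. With
   [u^n = T^-s], this works for every [s > rho beta / (beta + 1)] once [n] is
   large, where [rho] is the exponent of the [alpha]-rate. For [s] near that
   bound, [1 - s] exceeds the required exponent strictly, so that the constant in
   the theorem can be [1] and polylogarithmic factors are absorbed. *)

Require Import Defs.
From HB Require Import structures.
From mathcomp Require Import all_boot all_order all_algebra.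
From mathcomp Require Import all_classical all_reals all_analysis.
From mathcomp Require Import measurable_realfun ring lra.
Import Order.TTheory GRing.Theory Num.Theory.
Import numFieldNormedType.Exports.
Set Implicit Arguments.
Unset Strict Implicit.
Unset Printing Implicit Defensive.
Local Open Scope classical_set_scope.
Local Open Scope ring_scope.

(** * Gaussian demand *)

Section gaussian.
Context {R : realType}.
Implicit Types (m s : R) (f : R -> \bar R).
Notation mu := (@lebesgue_measure R).

(** The Radon-Nikodym derivative of the Gaussian law and its explicit density have the same integral
    over every measurable set, hence agree almost everywhere. *)
Lemma ge0_integral_normal_prob m s f :
  measurable_fun setT f -> (forall x, 0 <= f x)%E ->
  (\int[normal_prob m s]_x f x = \int[mu]_x (f x * (normal_pdf m s x)%:E))%E.
Proof.
move=> mf f0.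
have dom := normal_prob_dominates m s.
rewrite -(Radon_Nikodym_SigmaFinite.change_of_variables dom)//.
have mpdf : measurable_fun setT (fun x => (normal_pdf m s x)%:E).
  by apply/measurable_EFinP; exact: measurable_normal_pdf.
have mrn : measurable_fun setT
    (Radon_Nikodym_SigmaFinite.f (normal_prob m s) mu).
  exact: measurable_int (Radon_Nikodym_SigmaFinite.f_integrable dom).
apply: ae_eq_integral => //.
- exact: emeasurable_funM.
- exact: emeasurable_funM.
- have : ae_eq mu setT (Radon_Nikodym_SigmaFinite.f (normal_prob m s) mu)
      (fun x => (normal_pdf m s x)%:E).
    apply: integral_ae_eq => //.
    + exact: Radon_Nikodym_SigmaFinite.f_integrable.
    + by move=> A _ mA; rewrite -Radon_Nikodym_SigmaFinite.f_integral.
  by apply: filterS => x /= fg _; rewrite fg.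
Qed.

(** In the sum of the exponents for the means [m + D] and [m - D] the cross terms cancel; what
    remains is twice the exponent for mean [m], minus [D ^+ 2 / s ^+ 2]. *)
Lemma normal_pdf_shift m s (D x : R) : s != 0 ->
  normal_pdf (m + D) s x * (normal_pdf (m - D) s x * expR (D ^+ 2 / s ^+ 2)) =
  normal_pdf m s x ^+ 2.
Proof.
move=> s0; rewrite !normal_pdfE// /normal_fun.
set c := normal_peak s; set e1 := expR _; set e2 := expR _; set e3 := expR _.
set e0 := expR _.
suff -> : (c * e0) ^+ 2 = c ^+ 2 * (e1 * (e2 * e3)) by ring.
rewrite exprMn; congr (_ * _).
rewrite -!expRD -expRM_natl; congr expR.
by field.
Qed.

Lemma normal_pdf_gt0 m s (x : R) : s != 0 -> 0 < normal_pdf m s x.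
Proof.
move=> s0; rewrite normal_pdfE// mulr_gt0 ?normal_peak_gt0//.
exact: expR_gt0.
Qed.

(* Integrated over [x], this is Jensen's inequality combined with a change of
   mean. Cauchy-Schwarz against the density of mean [m - D] replaces the relative
   entropy of two Gaussians, so that no Gaussian moment is needed. *)
Lemma normal_pdf_tangent m s (D x B K q qb a : R) : s != 0 ->
  a = B - K * qb - D ^+ 2 / s ^+ 2 ->
  expR a * ((2 + K * qb) * normal_pdf m s x) <=
  expR (B - K * q) * normal_pdf (m + D) s x +
  expR a * (K * q * normal_pdf m s x + normal_pdf (m - D) s x).
Proof.
move=> s0 a_def.
have shift := normal_pdf_shift m D x s0.
have p0 := normal_pdf_gt0 m x s0.
have p1 := normal_pdf_gt0 (m + D) x s0.
have p2 := normal_pdf_gt0 (m - D) x s0.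
set N0 := normal_pdf m s x in shift p0 *.
set N1 := normal_pdf (m + D) s x in shift p1 *.
set N2 := normal_pdf (m - D) s x in shift p2 *.
set t := D ^+ 2 / s ^+ 2 in shift a_def.
pose X := expR ((B - K * q) / 2).
pose Y := expR ((B - K * qb) / 2).
have XX : expR (B - K * q) = X ^+ 2.
  by rewrite /X -expRM_natl; congr expR; field.
have aE : expR a * expR t = Y ^+ 2.
  by rewrite /Y -expRM_natl -expRD; congr expR; rewrite a_def; field.
have e0 : 0 < expR t by exact: expR_gt0.
have Y0 : 0 < Y by exact: expR_gt0.
(* Tangent of the exponential at [qb], taken for the square root [X] of the integrand. *)
have XY : Y * (2 + K * qb - K * q) <= 2 * X.
  have -> : X = Y * expR ((K * qb - K * q) / 2).
    by rewrite /X /Y -expRD; congr expR; field.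
  rewrite mulrCA ler_pM2l//.
  have := expR_ge1Dx ((K * qb - K * q) / 2); lra.
have ea : 0 < expR a by exact: expR_gt0.
rewrite XX.
suff : 0 <= (X ^+ 2 * N1 + expR a * N2 - expR a * (2 + K * qb - K * q) * N0).
  lra.
set E := expR a in aE ea *; set et := expR t in shift aE e0 *.
have Eq : E = Y ^+ 2 / et by rewrite -aE mulfK ?gt_eqF.
have N2q : N2 = N0 ^+ 2 / (N1 * et).
  by rewrite -shift; field; rewrite !gt_eqF.
rewrite Eq N2q.
(* Completing the square leaves a nonnegative multiple of the slack in [XY]. *)
have -> : X ^+ 2 * N1 + Y ^+ 2 / et * (N0 ^+ 2 / (N1 * et)) -
   Y ^+ 2 / et * (2 + K * qb - K * q) * N0 =
  (X * N1 - Y * N0 / et) ^+ 2 / N1 +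
  (2 * X - Y * (2 + K * qb - K * q)) * (Y * N0 / et).
  by field; rewrite !gt_eqF.
apply: addr_ge0.
  by rewrite mulr_ge0 ?sqr_ge0// invr_ge0 ltW.
by rewrite mulr_ge0 ?subr_ge0// divr_ge0 ?ltW// mulr_gt0.
Qed.

(** The tangent inequality integrates to [expR a * (2 + K * qb)] on the left and to
    [expR a * (K * qb + 1)] plus the wanted integral on the right; the difference is [expR a]. The
    penalty [D ^+ 2 / s ^+ 2] is twice the relative entropy of the two Gaussians. *)
Lemma normal_change_of_mean_Jensen m s (D B K b : R) (q : R -> R) :
  s != 0 -> 0 <= K -> measurable_fun setT q -> (forall x, 0 <= q x <= b) ->
  ((expR (B - K * fine (\int[normal_prob m s]_x (q x)%:E) - D ^+ 2 / s ^+ 2))%:E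
   <= \int[normal_prob (m + D) s]_x (expR (B - K * q x))%:E)%E.
Proof.
move=> s0 K0 mq q0b.
have q0 x : 0 <= q x by have /andP[] := q0b x.
have mE g : measurable_fun setT g -> measurable_fun setT (fun x : R => (g x)%:E).
  by move=> ?; apply/measurable_EFinP.
have meq : measurable_fun setT (fun x => expR (B - K * q x)).
  apply: measurableT_comp => //; apply: measurable_funB => //.
  exact: measurable_funM.
set qb := fine _; set a := _ - D ^+ 2 / s ^+ 2.
have qbE : (\int[normal_prob m s]_x (q x)%:E = qb%:E)%E.
  rewrite fineK// ge0_fin_numE; last by apply: integral_ge0 => x _; rewrite lee_fin.
  apply: (@le_lt_trans _ _ (\int[normal_prob m s]_x (cst b%:E x))%E).
    apply: ge0_le_integral => //=; first by move=> x _; rewrite lee_fin.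
    + exact: mE.
    + by move=> x _; rewrite lee_fin; have /andP[] := q0b x.
  rewrite integral_cst// [X in (_ * X)%E](_ : _ = 1%E) ?mule1 ?ltry//.
  exact: probability_setT.
have pdfm c := measurable_normal_pdf c s.
have pdf0 c x := normal_pdf_ge0 c s x.
have ea0 : 0 <= expR a by exact: expR_ge0.
have mqp : measurable_fun setT (fun x => K * q x * normal_pdf m s x).
  by apply: measurable_funM => //; exact: measurable_funM.
have I0 : (\int[mu]_x (K * q x * normal_pdf m s x)%:E = (K * qb)%:E)%E.
  rewrite EFinM -qbE ge0_integral_normal_prob//; last exact: mE.
  rewrite -ge0_integralZl//.
  - by apply: eq_integral => x _; rewrite -!EFinM mulrA.
  - by under eq_fun do rewrite -EFinM; apply: mE; exact: measurable_funM.
  - by move=> x _; rewrite -EFinM lee_fin mulr_ge0.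
have K0b : 0 <= K * qb.
  rewrite -lee_fin -I0; apply: integral_ge0 => x _; rewrite lee_fin.
  by rewrite !mulr_ge0.
have I1 : (\int[mu]_x (expR a * ((2 + K * qb) * normal_pdf m s x))%:E =
    (expR a * (2 + K * qb))%:E)%E.
  under eq_integral do rewrite mulrA EFinM.
  rewrite ge0_integralZl//.
  - by rewrite integral_normal_pdf mule1.
  - exact: mE.
  - by move=> x _; rewrite lee_fin.
  - by rewrite lee_fin mulr_ge0// addr_ge0.
have I2 : (\int[mu]_x (expR a *
      (K * q x * normal_pdf m s x + normal_pdf (m - D) s x))%:E =
    (expR a * (K * qb + 1))%:E)%E.
  under eq_integral do rewrite EFinM EFinD.
  rewrite ge0_integralZl//; last 2 first.
  - by under eq_fun do rewrite -EFinD; apply: mE; exact: measurable_funD.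
  - by move=> x _; rewrite -EFinD lee_fin addr_ge0// !mulr_ge0.
  rewrite ge0_integralD//=; last 4 first.
  - by move=> x _; rewrite lee_fin !mulr_ge0.
  - exact: mE.
  - by move=> x _; rewrite lee_fin.
  - exact: mE.
  by rewrite I0 integral_normal_pdf.
rewrite ge0_integral_normal_prob; [|exact: mE|by move=> x; rewrite lee_fin expR_ge0].
under eq_integral do rewrite -EFinM.
have main : (\int[mu]_x (expR a * ((2 + K * qb) * normal_pdf m s x))%:E <=
  \int[mu]_x (expR (B - K * q x) * normal_pdf (m + D) s x)%:E +
  \int[mu]_x (expR a *
      (K * q x * normal_pdf m s x + normal_pdf (m - D) s x))%:E)%E.
  rewrite -ge0_integralD//=; last 4 first.
  - by move=> x _; rewrite lee_fin mulr_ge0// expR_ge0.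
  - by apply: mE; exact: measurable_funM.
  - by move=> x _; rewrite lee_fin mulr_ge0// addr_ge0// !mulr_ge0.
  - by apply: mE; apply: measurable_funM => //; exact: measurable_funD.
  apply: ge0_le_integral => //=.
  - by move=> x _; rewrite lee_fin !mulr_ge0// addr_ge0.
  - by apply: mE; do 2 apply: measurable_funM => //.
  - apply: emeasurable_funD; apply: mE; apply: measurable_funM => //.
    exact: measurable_funD.
  - by move=> x _; rewrite -EFinD lee_fin; exact: normal_pdf_tangent.
move: main; rewrite I1 I2 -leeBlDr// -EFinB; apply: le_trans.
by rewrite lee_fin; lra.
Qed.

Lemma expR_Jensen (P : {measure set R -> \bar R}) (B K b : R) (q : R -> R) :
  P setT = 1%E -> 0 <= K -> measurable_fun setT q -> (forall x, 0 <= q x <= b) ->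
  ((expR (B - K * fine (\int[P]_x (q x)%:E)))%:E
   <= \int[P]_x (expR (B - K * q x))%:E)%E.
Proof.
move=> P1 K0 mq q0b.
have q0 x : 0 <= q x by have /andP[] := q0b x.
have mE g : measurable_fun setT g -> measurable_fun setT (fun x : R => (g x)%:E).
  by move=> ?; apply/measurable_EFinP.
have meq : measurable_fun setT (fun x => expR (B - K * q x)).
  apply: measurableT_comp => //; apply: measurable_funB => //.
  exact: measurable_funM.
set qb := fine _; set a := B - _.
have qbE : (\int[P]_x (q x)%:E = qb%:E)%E.
  rewrite fineK// ge0_fin_numE; last by apply: integral_ge0 => x _; rewrite lee_fin.
  apply: (@le_lt_trans _ _ (\int[P]_x (cst b%:E x))%E).
    apply: ge0_le_integral => //=; first by move=> x _; rewrite lee_fin.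
    + exact: mE.
    + by move=> x _; rewrite lee_fin; have /andP[] := q0b x.
  by rewrite integral_cst// P1 mule1 ltry.
have ea0 : 0 <= expR a by exact: expR_ge0.
have qb0 : 0 <= qb.
  by rewrite -lee_fin -qbE; apply: integral_ge0 => x _; rewrite lee_fin.
(* The linear term of the tangent is moved to the right, so that only nonnegative functions are
   integrated. *)
have : (\int[P]_x (cst (expR a * (1 + K * qb))%:E x) <=
   \int[P]_x (expR (B - K * q x))%:E + \int[P]_x (expR a * K * q x)%:E)%E.
  rewrite -ge0_integralD//=; last 3 first.
  - exact: mE.
  - by move=> x _; rewrite lee_fin !mulr_ge0.
  - by apply: mE; exact: measurable_funM.
  apply: ge0_le_integral => //=.
  - by move=> x _; rewrite lee_fin mulr_ge0// addr_ge0// mulr_ge0.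
  - apply: emeasurable_funD; apply: mE => //.
    exact: measurable_funM.
  - move=> x _; rewrite -EFinD lee_fin.
    have -> : expR (B - K * q x) = expR a * expR (K * qb - K * q x).
      by rewrite -expRD; congr expR; rewrite /a; ring.
    have := ler_wpM2l ea0 (expR_ge1Dx (K * qb - K * q x)); lra.
rewrite integral_cst// P1 mule1.
under [X in (_ <= _ + X)%E]eq_integral do rewrite EFinM.
rewrite ge0_integralZl//; last 3 first.
- exact: mE.
- by move=> x _; rewrite lee_fin.
- by rewrite lee_fin mulr_ge0.
rewrite qbE -EFinM -leeBlDr// -EFinB; apply: le_trans.
by rewrite lee_fin; lra.
Qed.

End gaussian.

(** * One pricing round *)

Lemma measurable_section {R : realType} d1 d2 (X : measurableType d1)
    (Y : measurableType d2) (V : X * Y -> \bar R) (h : X) :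
  measurable_fun setT V -> measurable_fun setT (fun z => V (h, z)).
Proof. by move=> mV; apply: measurableT_comp => //; exact: pair1_measurable. Qed.

Section round.
Context {R : realType}.
Variables (sigma : R).
Hypothesis sigma0 : sigma != 0.

(** Written with densities, this integrates a jointly measurable function against the fixed Lebesgue
    measure, so Tonelli applies. *)
Lemma measurable_integral_normal d (X : measurableType d) (m : X -> R)
    (F : X * R -> \bar R) :
  measurable_fun setT m -> measurable_fun setT F -> (forall z, 0 <= F z)%E ->
  measurable_fun setT (fun x => \int[normal_prob (m x) sigma]_d F (x, d))%E.
Proof.
move=> mm mF F0.
under eq_fun => x.
  rewrite ge0_integral_normal_prob//; last first.
    by apply: measurableT_comp => //; exact: pair1_measurable.
  over.
have := @measurable_fun_fubini_tonelli_F _ _ X (measurableTypeR R) R lebesgue_measure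
  (fun z => F z * (normal_pdf (m z.1) sigma z.2)%:E)%E.
apply.
- apply: emeasurable_funM => //; apply/measurable_EFinP.
  rewrite [X in measurable_fun _ X](_ : _ = fun z : X * R => normal_peak sigma *
    expR (- (z.2 - m z.1) ^+ 2 / (sigma ^+ 2 *+ 2))); last first.
    by apply/funext => z; rewrite normal_pdfE.
  apply: measurable_funM => //; apply: measurableT_comp => //.
  apply: measurable_funM => //; apply: measurableT_comp => //.
  apply: measurable_funX; apply: measurable_funB => //.
  by apply: measurableT_comp.
- by move=> z; rewrite mule_ge0// lee_fin normal_pdf_ge0.
Qed.

(** The one-step Bellman operator of a fixed policy: [P] is the law of the price, [c] the immediate
    cost and [V] the cost of the later rounds. *)
Definition round (f : R -> R) (c : R -> \bar R) (P : {measure set R -> \bar R})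
    (V : R * R -> \bar R) : \bar R :=
  (\int[P]_p (c p + \int[normal_prob (f p) sigma]_d V (p, d)))%E.

Lemma round_ge0 f c P V : (forall p, 0 <= c p)%E -> (forall z, 0 <= V z)%E ->
  (0 <= round f c P V)%E.
Proof.
move=> c0 V0; apply: integral_ge0 => p _; rewrite adde_ge0//.
exact: integral_ge0.
Qed.

Lemma measurable_round d (X : measurableType d) (k : R.-pker X ~> R) f c
    (V : X * (R * R) -> \bar R) :
  measurable_fun setT f ->
  measurable_fun setT c -> (forall p, 0 <= c p)%E ->
  measurable_fun setT V -> (forall z, 0 <= V z)%E ->
  measurable_fun setT (fun h => round f c (k h) (fun z => V (h, z))).
Proof.
move=> mf mc c0 mV V0.
apply: (measurable_fun_integral_sfinite_kernel
  (fun z : X * R => c z.2 +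
     \int[normal_prob (f z.2) sigma]_d V (z.1, (z.2, d)))%E k).
  by move=> z; rewrite adde_ge0// integral_ge0.
apply: emeasurable_funD; first exact: measurableT_comp.
apply: (@measurable_integral_normal _ (X * R)%type (fun z => f z.2)
   (fun z => V (z.1.1, (z.1.2, z.2)))) => //.
  exact: measurableT_comp.
apply: measurableT_comp => //.
apply: measurable_fun_pair => /=; first exact: measurableT_comp.
by apply: measurable_fun_pair => //=; exact: measurableT_comp.
Qed.

Section fixed_history.
Variable P : {measure set R -> \bar R}.
Hypothesis P1 : P setT = 1%E.
Implicit Types (f : R -> R) (c : R -> \bar R) (V : R * R -> \bar R).

Lemma measurable_round_inner f V : measurable_fun setT f ->
  measurable_fun setT V -> (forall z, 0 <= V z)%E ->
  measurable_fun setT (fun p => \int[normal_prob (f p) sigma]_d V (p, d))%E.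
Proof. exact: measurable_integral_normal. Qed.

Lemma measurable_round_integrand f c V : measurable_fun setT f ->
  measurable_fun setT c ->
  measurable_fun setT V -> (forall z, 0 <= V z)%E ->
  measurable_fun setT (fun p => c p + \int[normal_prob (f p) sigma]_d V (p, d))%E.
Proof.
by move=> *; apply: emeasurable_funD => //; exact: measurable_round_inner.
Qed.

Lemma le_round f c1 c2 V1 V2 : measurable_fun setT f ->
  measurable_fun setT c1 -> measurable_fun setT c2 ->
  measurable_fun setT V1 -> measurable_fun setT V2 ->
  (forall p, 0 <= c1 p)%E -> (forall z, 0 <= V1 z)%E ->
  (forall p, c1 p <= c2 p)%E -> (forall z, V1 z <= V2 z)%E ->
  (round f c1 P V1 <= round f c2 P V2)%E.
Proof.
move=> mf mc1 mc2 mV1 mV2 c10 V10 c12 V12.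
have V20 z : (0 <= V2 z)%E by exact: le_trans (V12 z).
apply: ge0_le_integral => //.
- by move=> p _; rewrite adde_ge0// integral_ge0.
- exact: measurable_round_integrand.
- exact: measurable_round_integrand.
- move=> p _; apply: leeD => //; apply: ge0_le_integral => //.
  + exact: measurable_section.
  + exact: measurable_section.
Qed.

Lemma roundD f c1 c2 V1 V2 : measurable_fun setT f ->
  measurable_fun setT c1 -> measurable_fun setT c2 ->
  measurable_fun setT V1 -> measurable_fun setT V2 ->
  (forall p, 0 <= c1 p)%E -> (forall p, 0 <= c2 p)%E ->
  (forall z, 0 <= V1 z)%E -> (forall z, 0 <= V2 z)%E ->
  (round f (c1 \+ c2) P (V1 \+ V2) = round f c1 P V1 + round f c2 P V2)%E.
Proof.
move=> mf mc1 mc2 mV1 mV2 c10 c20 V10 V20.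
rewrite /round -ge0_integralD//; last 4 first.
- by move=> p _; rewrite adde_ge0// integral_ge0.
- exact: measurable_round_integrand.
- by move=> p _; rewrite adde_ge0// integral_ge0.
- exact: measurable_round_integrand.
apply: eq_integral => p _ /=.
rewrite ge0_integralD//; [|exact: measurable_section|exact: measurable_section].
by rewrite addeACA.
Qed.

Lemma roundZ f c V (k : R) : 0 <= k -> measurable_fun setT f ->
  measurable_fun setT c -> measurable_fun setT V ->
  (forall p, 0 <= c p)%E -> (forall z, 0 <= V z)%E ->
  (round f (fun p => k%:E * c p) P (fun z => k%:E * V z) = k%:E * round f c P V)%E.
Proof.
move=> k0 mf mc mV c0 V0; rewrite /round -ge0_integralZl//; last 2 first.
- exact: measurable_round_integrand.
- by move=> p _; rewrite adde_ge0// integral_ge0.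
apply: eq_integral => p _; rewrite ge0_integralZl//; last exact: measurable_section.
by rewrite [RHS]ge0_muleDr// integral_ge0.
Qed.

Lemma round_le_cst f c V (a b : R) : measurable_fun setT f ->
  measurable_fun setT c -> measurable_fun setT V ->
  (forall p, 0 <= c p)%E -> (forall z, 0 <= V z)%E ->
  (forall p, c p <= a%:E)%E -> (forall z, V z <= b%:E)%E ->
  (round f c P V <= (a + b)%:E)%E.
Proof.
move=> mf mc mV c0 V0 ca Vb.
apply: (le_trans (le_round _ _ (measurable_cst a%:E) _ (measurable_cst b%:E)
  c0 V0 ca Vb)) => //.
rewrite /round; under eq_integral => p _.
  rewrite integral_cst// [X in (_ * X)%E](_ : _ = 1%E) ?mule1; last first.
    exact: probability_setT.
  over.
by rewrite integral_cst//= P1 mule1.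
Qed.

(** By additivity the complement of [D] is a null set of prices. *)
Lemma ae_eq_round f c1 c2 V (D : set R) : measurable D -> P D = 1%E ->
  measurable_fun setT f -> measurable_fun setT c1 -> measurable_fun setT c2 ->
  measurable_fun setT V -> (forall z, 0 <= V z)%E ->
  (forall p, D p -> c1 p = c2 p) -> round f c1 P V = round f c2 P V.
Proof.
move=> mD PD mf mc1 mc2 mV V0 c12; apply: ae_eq_integral => //.
- exact: measurable_round_integrand.
- exact: measurable_round_integrand.
- exists (~` D); split.
  + exact: measurableC.
  + have : P (D `|` ~` D) = (P D + P (~` D))%E.
      exact: (measureU P mD (measurableC mD) (setICr D)).
    rewrite setUCr P1 PD; case: (P (~` D)) => //= r [].
    by move=> /eqP; rewrite -subr_eq0 opprD addrA subrr sub0r oppr_eq0 => /eqP ->.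
  + by move=> p /= H Dp; apply: H => _; rewrite c12.
Qed.

(* One round of the change of measure: [N] counts the prices set in [bin], where
   the two demand functions differ, and [V] collects a cost that is at least
   [D] outside of [bin]. *)
Lemma round_change_of_measure f0 f1 (bin : set R) (g : R -> \bar R)
    (N V : R * R -> \bar R) (lam S D B E b : R) :
  0 < lam -> 0 <= S -> 0 < D -> 1 <= E -> measurable bin ->
  measurable_fun setT f0 -> measurable_fun setT f1 ->
  measurable_fun setT g -> measurable_fun setT N -> measurable_fun setT V ->
  (forall p, 0 <= g p)%E -> (forall z, 0 <= N z <= b%:E)%E ->
  (forall z, 0 <= V z)%E ->
  (forall p, ~ bin p -> D%:E <= g p)%E ->
  (forall p, ~ bin p -> f1 p = f0 p) ->
  (forall p, (f1 p - f0 p) ^+ 2 / sigma ^+ 2 <= S) ->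
  (forall z, (expR (B - (lam + S) * fine (N z)))%:E <=
     1 + (E * lam / D)%:E * V z)%E ->
  ((expR (B + lam - (lam + S) * fine (round f0 (fun p => (\1_bin p)%:E) P N)))%:E
   <= 1 + (E * expR lam * lam / D)%:E * round f1 g P V)%E.
Proof.
move=> lam0 S0 D0 E1 mbin mf0 mf1 mg mN mV g0 N0b V0 gD f01 fS IH.
have N0 z : (0 <= N z)%E by have /andP[] := N0b z.
have Nfin z : N z \is a fin_num.
  rewrite ge0_fin_numE//; have /andP[_ /le_lt_trans] := N0b z; apply; exact: ltry.
set K := lam + S; have K0 : 0 <= K by rewrite addr_ge0// ltW.
set G := E * expR lam * lam / D.
have eG : 0 < expR lam by exact: expR_gt0.
have E0 : 0 < E by exact: lt_le_trans E1.
have c0 : 0 <= E * lam / D by apply/ltW; rewrite divr_gt0// mulr_gt0.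
have G0 : 0 <= G by apply/ltW; rewrite divr_gt0// !mulr_gt0.
pose n p d : R := fine (N (p, d)).
have nE p d : (n p d)%:E = N (p, d) by rewrite fineK.
have n0b p d : 0 <= n p d <= b.
  by rewrite -!lee_fin nE.
have mn p : measurable_fun setT (n p).
  by apply: measurableT_comp => //; exact: measurable_section.
pose nb p : R := fine (\int[normal_prob (f0 p) sigma]_d N (p, d))%E.
have int_fin p : (\int[normal_prob (f0 p) sigma]_d N (p, d) <= b%:E)%E.
  apply: (@le_trans _ _ (\int[normal_prob (f0 p) sigma]_d (cst b%:E d))%E).
    apply: ge0_le_integral => //; first exact: measurable_section.
    by move=> d _; have /andP[] := N0b (p, d).
  rewrite integral_cst// [X in (_ * X)%E](_ : _ = 1%E) ?mule1//.
  exact: probability_setT.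
have int_ge0 p : (0 <= \int[normal_prob (f0 p) sigma]_d N (p, d))%E.
  exact: integral_ge0.
have nbE p : (nb p)%:E = (\int[normal_prob (f0 p) sigma]_d N (p, d))%E.
  by rewrite fineK// ge0_fin_numE//; exact: le_lt_trans (int_fin p) (ltry _).
have nb0b p : 0 <= nb p <= b by rewrite -!lee_fin nbE int_ge0/=.
have mnb : measurable_fun setT nb.
  by apply: measurableT_comp => //; exact: measurable_round_inner.
pose q p : R := \1_bin p + nb p.
have mq : measurable_fun setT q.
  by apply: measurable_funD => //; exact: measurable_indic.
have i0 p : 0 <= (\1_bin p : R) <= 1.
  by rewrite indicE; case: (_ \in _); rewrite ?lexx ler01.
have q0b p : 0 <= q p <= 1 + b.
  have /andP[a1 a2] := nb0b p; have /andP[a3 a4] := i0 p.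
  by rewrite addr_ge0//= lerD.
have -> : round f0 (fun p => (\1_bin p)%:E) P N = (\int[P]_p (q p)%:E)%E.
  by apply: eq_integral => p _; rewrite EFinD nbE.
apply: (le_trans (expR_Jensen _ P1 K0 mq q0b)).
pose W p := (\int[normal_prob (f1 p) sigma]_d V (p, d))%E.
have W0 p : (0 <= W p)%E by exact: integral_ge0.
have -> : (1 + G%:E * round f1 g P V = \int[P]_p (1 + G%:E * (g p + W p)))%E.
  rewrite ge0_integralD//; last 2 first.
  - by move=> p _; rewrite mule_ge0// adde_ge0.
  - apply: measurable_funeM; exact: measurable_round_integrand.
  rewrite integral_cst// P1 mule1 ge0_integralZl//.
  - exact: measurable_round_integrand.
  - by move=> p _; rewrite adde_ge0.
(* At a fixed price: the Gaussian change of mean from [f0 p] to [f1 p], then the bound [IH] on the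
   later rounds. *)
have gauss p B' : (B' = B -> (expR (B' - K * nb p -
     (f1 p - f0 p) ^+ 2 / sigma ^+ 2))%:E <= 1 + (E * lam / D)%:E * W p)%E.
  move=> ->.
  have := normal_change_of_mean_Jensen (f0 p) (f1 p - f0 p) B sigma0 K0
    (mn p) (n0b p).
  rewrite (_ : f0 p + (f1 p - f0 p) = f1 p); last by ring.
  under eq_integral do rewrite nE.
  move=> /le_trans; apply.
  have -> : (1 + (E * lam / D)%:E * W p = \int[normal_prob (f1 p) sigma]_d
      (1 + (E * lam / D)%:E * V (p, d)))%E.
    rewrite ge0_integralD//; last 2 first.
    - by move=> d _; rewrite mule_ge0.
    - by apply: measurable_funeM; exact: measurable_section.
    rewrite integral_cst// [X in (1 * X)%E](_ : _ = 1%E); last first.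
      exact: probability_setT.
    by rewrite mule1 ge0_integralZl//; exact: measurable_section.
  apply: ge0_le_integral => //.
  - apply/measurable_EFinP/measurableT_comp => //.
    apply: measurable_funB => //; apply: measurable_funM => //.
    exact: mn.
  - apply: emeasurable_funD => //.
    by apply: measurable_funeM; exact: measurable_section.
  - by move=> d _; exact: IH.
apply: ge0_le_integral => //.
- apply/measurable_EFinP/measurableT_comp => //.
  by apply: measurable_funB => //; exact: measurable_funM.
- apply: emeasurable_funD => //.
  by apply: measurable_funeM; exact: measurable_round_integrand.
move=> p _; have [binp|nbinp] := pselect (bin p).
(* Inside the bin the indicator contributes [- (lam + S)] to the exponent: [lam] cancels the
   increment of the round and [S] pays for the change of demand. The cost [g p] may be dropped. *)
- apply: (@le_trans _ _ (1 + (E * lam / D)%:E * W p)%E).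
    apply: le_trans (gauss p B erefl); rewrite lee_fin ler_expR.
    rewrite /q indicE mem_set//= /K; have := fS p; lra.
  apply: leeD => //; apply: lee_pmul => //.
    rewrite lee_fin (_ : G = expR lam * (E * lam / D)); last by rewrite /G; ring.
    by rewrite ler_peMl// -[leLHS]expR0 ler_expR ltW.
  by rewrite leeDr.
(* Outside the bin the demands agree, so the change of mean is free. The factor [expR lam] is paid
   by the cost [D], since [expR lam <= 1 + expR lam * lam]. *)
- have -> : expR (B + lam - K * q p) = expR lam * expR (B - K * nb p).
    rewrite -expRD; congr expR; rewrite /q indicE memNset//= add0r; ring.
  have := gauss p B erefl; rewrite f01// subrr expr0n/= mul0r subr0 => h.
  rewrite EFinM.
  apply: (@le_trans _ _ ((expR lam)%:E * (1 + (E * lam / D)%:E * W p))%E).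
    by apply: lee_pmul => //; rewrite lee_fin ltW.
  rewrite ge0_muleDr ?mule_ge0// mule1 muleA -EFinM.
  rewrite [X in (_ <= 1 + X)%E]ge0_muleDr// addeA.
  have -> : expR lam * (E * lam / D) = G by rewrite /G; ring.
  apply: leeD => //.
  apply: (@le_trans _ _ (1 + G%:E * D%:E)%E); last first.
    by apply: leeD => //; apply: lee_pmul => //; [rewrite lee_fin ltW|exact: gD].
  rewrite -EFinM -EFinD lee_fin /G divfK ?gt_eqF//.
  have e1 : expR lam * (1 - lam) <= 1.
    have := expR_ge1Dx (- lam); rewrite expRN.
    by rewrite -(ler_pM2l eG) divff ?gt_eqF// mulrC.
  have : expR lam * lam <= E * (expR lam * lam).
    by rewrite ler_peMl// mulr_ge0 ?(ltW eG) ?(ltW lam0).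
  lra.
Qed.

End fixed_history.
End round.

(** * Expected costs of a policy *)

Section policy_value.
Context {R : realType}.
Variables (pmin sigma : R) (pi : policy pmin).
Hypothesis sigma0 : sigma != 0.
Implicit Types (f : R -> R) (c : R -> \bar R).

(** The recursion of [regret_rest] for an arbitrary cost [c] per price: the gap gives the regret,
    the indicator of a bin the expected number of visits. *)
Fixpoint value f c (m n : nat) {struct m} : hist R n -> \bar R :=
  match m with
  | 0 => fun _ => 0%E
  | m'.+1 => fun h => round sigma f c (pol_next pi n h)
      (fun z => @value f c m' n.+1 ((h, z) : hist R n.+1))
  end.

Definition total_value f c (T : nat) : \bar R :=
  match T with
  | 0 => 0%E
  | T'.+1 => round sigma f c (pol_first pi)
      (fun z => @value f c T' 0 (z : hist R 0))
  end.

Lemma value_ge0 f c m n (h : hist R n) :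
  (forall p, 0 <= c p)%E -> (0 <= value f c m h)%E.
Proof.
move=> c0; elim: m n h => [|m IH] n h //=.
by apply: round_ge0 => // z; exact: IH.
Qed.

Lemma measurable_value f c m n : measurable_fun setT f ->
  measurable_fun setT c -> (forall p, 0 <= c p)%E ->
  measurable_fun setT (@value f c m n).
Proof.
move=> mf mc c0; elim: m n => [|m IH] n /=; first exact: measurable_cst.
apply: (measurable_round sigma0 (pol_next pi n) mf mc c0 (IH n.+1)).
by move=> z; exact: value_ge0.
Qed.

Lemma measurable_value_next f c m n (h : hist R n) : measurable_fun setT f ->
  measurable_fun setT c -> (forall p, 0 <= c p)%E ->
  measurable_fun setT (fun z : R * R => @value f c m n.+1 ((h, z) : hist R n.+1)).
Proof.
move=> mf mc c0; have := @measurable_value f c m n.+1 mf mc c0.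
exact: (@measurable_section R _ _ (hist R n) (R * R)%type (@value f c m n.+1) h).
Qed.

Lemma pol_next_setT n (h : hist R n) : pol_next pi n h setT = 1%E.
Proof. exact: prob_kernel. Qed.

Lemma pol_first_setT : pol_first pi setT = 1%E.
Proof. exact: probability_setT. Qed.

Lemma le_value f c1 c2 m n (h : hist R n) : measurable_fun setT f ->
  measurable_fun setT c1 -> measurable_fun setT c2 ->
  (forall p, 0 <= c1 p)%E -> (forall p, c1 p <= c2 p)%E ->
  (value f c1 m h <= value f c2 m h)%E.
Proof.
move=> mf mc1 mc2 c10 c12.
have c20 p : (0 <= c2 p)%E by exact: le_trans (c12 p).
elim: m n h => [|m IH] n h; first exact: lexx.
apply: le_round => //.
- exact: measurable_value_next.
- exact: measurable_value_next.
- by move=> z; exact: value_ge0.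
Qed.

Lemma le_total_value f c1 c2 T : measurable_fun setT f ->
  measurable_fun setT c1 -> measurable_fun setT c2 ->
  (forall p, 0 <= c1 p)%E -> (forall p, c1 p <= c2 p)%E ->
  (total_value f c1 T <= total_value f c2 T)%E.
Proof.
move=> mf mc1 mc2 c10 c12.
have c20 p : (0 <= c2 p)%E by exact: le_trans (c12 p).
case: T => [|T]; first exact: lexx.
apply: le_round => //.
- exact: (@measurable_value _ _ T 0).
- exact: (@measurable_value _ _ T 0).
- by move=> z; exact: value_ge0.
- by move=> z; exact: le_value.
Qed.

Lemma valueD f c1 c2 m n (h : hist R n) : measurable_fun setT f ->
  measurable_fun setT c1 -> measurable_fun setT c2 ->
  (forall p, 0 <= c1 p)%E -> (forall p, 0 <= c2 p)%E ->
  (value f (c1 \+ c2) m h = value f c1 m h + value f c2 m h)%E.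
Proof.
move=> mf mc1 mc2 c10 c20.
elim: m n h => [|m IH] n h /=; first by rewrite adde0.
transitivity (round sigma f (c1 \+ c2) (pol_next pi n h)
  ((fun z => @value f c1 m n.+1 ((h, z) : hist R n.+1)) \+
   (fun z => @value f c2 m n.+1 ((h, z) : hist R n.+1)))%E).
  by congr round; apply/funext => z; exact: IH.
apply: roundD => //.
- exact: measurable_value_next.
- exact: measurable_value_next.
- by move=> z; exact: value_ge0.
- by move=> z; exact: value_ge0.
Qed.

Lemma total_valueD f c1 c2 T : measurable_fun setT f ->
  measurable_fun setT c1 -> measurable_fun setT c2 ->
  (forall p, 0 <= c1 p)%E -> (forall p, 0 <= c2 p)%E ->
  (total_value f (c1 \+ c2) T = total_value f c1 T + total_value f c2 T)%E.
Proof.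
move=> mf mc1 mc2 c10 c20; case: T => [|T] /=; first by rewrite adde0.
transitivity (round sigma f (c1 \+ c2) (pol_first pi)
  ((fun z => @value f c1 T 0 (z : hist R 0)) \+
   (fun z => @value f c2 T 0 (z : hist R 0)))%E).
  by congr round; apply/funext => z; exact: valueD.
apply: roundD => //.
- exact: (@measurable_value _ _ T 0).
- exact: (@measurable_value _ _ T 0).
- by move=> z; exact: value_ge0.
- by move=> z; exact: value_ge0.
Qed.

Lemma valueZ f c (k : R) m n (h : hist R n) : 0 <= k -> measurable_fun setT f ->
  measurable_fun setT c -> (forall p, 0 <= c p)%E ->
  (value f (fun p => k%:E * c p) m h = k%:E * value f c m h)%E.
Proof.
move=> k0 mf mc c0; elim: m n h => [|m IH] n h /=; first by rewrite mule0.
transitivity (round sigma f (fun p => k%:E * c p) (pol_next pi n h)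
  (fun z => k%:E * @value f c m n.+1 ((h, z) : hist R n.+1)))%E.
  by congr round; apply/funext => z; exact: IH.
apply: roundZ => //.
- exact: measurable_value_next.
- by move=> z; exact: value_ge0.
Qed.

Lemma total_valueZ f c (k : R) T : 0 <= k -> measurable_fun setT f ->
  measurable_fun setT c -> (forall p, 0 <= c p)%E ->
  (total_value f (fun p => k%:E * c p) T = k%:E * total_value f c T)%E.
Proof.
move=> k0 mf mc c0; case: T => [|T] /=; first by rewrite mule0.
transitivity (round sigma f (fun p => k%:E * c p) (pol_first pi)
  (fun z => k%:E * @value f c T 0 (z : hist R 0)))%E.
  by congr round; apply/funext => z; exact: valueZ.
apply: roundZ => //.
- exact: (@measurable_value _ _ T 0).
- by move=> z; exact: value_ge0.
Qed.

Lemma total_value_ge0 f c T : (forall p, 0 <= c p)%E -> (0 <= total_value f c T)%E.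
Proof.
by move=> c0; case: T => [|T] //=; apply: round_ge0 => // z; exact: value_ge0.
Qed.

(** Meant for disjoint bins: their weighted visit counts together stay below the regret. *)
Lemma sum_total_value f (I : Type) (s : seq I) (c : I -> R -> \bar R)
    (g : R -> \bar R) T :
  measurable_fun setT f -> (forall i, measurable_fun setT (c i)) ->
  measurable_fun setT g ->
  (forall i p, 0 <= c i p)%E -> (forall p, \sum_(i <- s) c i p <= g p)%E ->
  (\sum_(i <- s) total_value f (c i) T <= total_value f g T)%E.
Proof.
move=> mf mc mg c0 cg.
suff -> : (\sum_(i <- s) total_value f (c i) T =
           total_value f (fun p => \sum_(i <- s) c i p) T)%E.
  apply: le_total_value => //; first exact: emeasurable_sum.
  by move=> p; exact: sume_ge0.
elim: s {cg} => [|i s IH].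
  (* The zero cost has value 0 by homogeneity with factor 0. *)
  rewrite big_nil (_ : (fun _ => _) = (fun p => 0%:E * cst 0 p))%E.
    by rewrite total_valueZ// mul0e.
  by apply/funext => p; rewrite big_nil mule0.
rewrite big_cons IH.
transitivity (total_value f (c i \+ (fun p => \sum_(j <- s) c j p)) T)%E.
  apply/esym/total_valueD => //; first exact: emeasurable_sum.
  by move=> p; exact: sume_ge0.
by congr (total_value f _ T); apply/funext => p; rewrite big_cons.
Qed.

Lemma value_le f c m n (h : hist R n) : measurable_fun setT f ->
  measurable_fun setT c -> (forall p, 0 <= c p)%E -> (forall p, c p <= 1)%E ->
  (value f c m h <= m%:R%:E)%E.
Proof.
move=> mf mc c0 c1; elim: m n h => [|m IH] n h; first exact: lexx.
rewrite -natr1 [m%:R + 1]addrC; apply: round_le_cst => //.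
- exact: pol_next_setT.
- exact: measurable_value_next.
- by move=> z; exact: value_ge0.
Qed.

Lemma total_value_le f c T : measurable_fun setT f ->
  measurable_fun setT c -> (forall p, 0 <= c p)%E -> (forall p, c p <= 1)%E ->
  (total_value f c T <= T%:R%:E)%E.
Proof.
move=> mf mc c0 c1; case: T => [|T]; first exact: lexx.
rewrite -natr1 [T%:R + 1]addrC; apply: round_le_cst => //.
- exact: pol_first_setT.
- exact: (@measurable_value _ _ T 0).
- by move=> z; exact: value_ge0.
- by move=> z; exact: value_le.
Qed.

(* Prices leave [pmin, 1] with probability 0, so the cost may be redefined
   there. *)
Lemma regret_rest_value f c m n (h : hist R n) : measurable_fun setT f ->
  measurable_fun setT c -> (forall p, 0 <= c p)%E ->
  (forall p, p \in `[pmin, 1] -> c p = (gap pmin f p)%:E) ->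
  regret_rest sigma f pi m h = value f c m h.
Proof.
move=> mf mc c0 cE.
have mgap : measurable_fun setT (fun p => (gap pmin f p)%:E).
  apply/measurable_EFinP; apply: measurable_funB => //.
  exact: measurable_funM.
elim: m n h => [|m IH] n h; first by [].
transitivity (round sigma f (fun p => (gap pmin f p)%:E) (pol_next pi n h)
    (fun z => @value f c m n.+1 ((h, z) : hist R n.+1))).
  apply: eq_integral => p _; congr (_ + _)%E.
  by apply: eq_integral => d _; exact: IH.
apply: (@ae_eq_round _ _ sigma0 _ (pol_next_setT h) _ _ _ _ `[pmin, 1]%classic) => //.
- exact: pol_next_supp.
- exact: measurable_value_next.
- by move=> z; exact: value_ge0.
- by move=> p /= pI; rewrite cE.
Qed.

Lemma regret_value f c T : measurable_fun setT f ->
  measurable_fun setT c -> (forall p, 0 <= c p)%E ->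
  (forall p, p \in `[pmin, 1] -> c p = (gap pmin f p)%:E) ->
  regret sigma f pi T = total_value f c T.
Proof.
move=> mf mc c0 cE.
have mgap : measurable_fun setT (fun p => (gap pmin f p)%:E).
  apply/measurable_EFinP; apply: measurable_funB => //.
  exact: measurable_funM.
case: T => [|T]; first by [].
transitivity (round sigma f (fun p => (gap pmin f p)%:E) (pol_first pi)
    (fun z => @value f c T 0 (z : hist R 0))).
  apply: eq_integral => p _; congr (_ + _)%E.
  by apply: eq_integral => d _; exact: regret_rest_value.
apply: (@ae_eq_round _ _ sigma0 _ pol_first_setT _ _ _ _ `[pmin, 1]%classic) => //.
- exact: pol_first_supp.
- exact: (@measurable_value _ _ T 0).
- by move=> z; exact: value_ge0.
- by move=> p /= pI; rewrite cE.
Qed.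

(** * Change of measure over all rounds *)

Section change_of_measure.
Variables (f0 f1 : R -> R) (bin : set R) (g : R -> \bar R) (S D : R).
Hypotheses (S0 : 0 <= S) (D0 : 0 < D) (mbin : measurable bin).
Hypotheses (mf0 : measurable_fun setT f0) (mf1 : measurable_fun setT f1).
Hypotheses (mg : measurable_fun setT g) (g0 : forall p, (0 <= g p)%E).
Hypothesis gD : forall p, ~ bin p -> (D%:E <= g p)%E.
Hypothesis f01 : forall p, ~ bin p -> f1 p = f0 p.
Hypothesis fS : forall p, (f1 p - f0 p) ^+ 2 / sigma ^+ 2 <= S.

Let b p : \bar R := (\1_bin p)%:E.
Let mb : measurable_fun setT b.
Proof. by apply/measurable_EFinP; exact: measurable_indic. Qed.
Let b0 p : (0 <= b p)%E.
Proof. by rewrite lee_fin indicE; case: (_ \in _); rewrite ?ler01. Qed.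
Let b1 p : (b p <= 1)%E.
Proof. by rewrite lee_fin indicE; case: (_ \in _); rewrite ?ler01. Qed.

(** Backward induction: each round adds [lam] to the exponent and multiplies the coefficient by
    [expR lam]; with no round left both sides are 1. *)
Lemma value_change_of_measure (lam : R) m n (h : hist R n) : 0 < lam ->
  ((expR (lam * m%:R - (lam + S) * fine (value f0 b m h)))%:E <=
   1 + (expR (lam * m%:R) * lam / D)%:E * value f1 g m h)%E.
Proof.
move=> lam0; elim: m n h => [|m IH] n h.
  by rewrite /= mule0 adde0 !mulr0 subr0 expR0.
rewrite -natr1 mulrDr mulr1 [in leRHS]expRD.
have := @round_change_of_measure R sigma sigma0 (pol_next pi n h)
  (pol_next_setT h) f0 f1 bin g
  (fun z => @value f0 b m n.+1 ((h, z) : hist R n.+1))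
  (fun z => @value f1 g m n.+1 ((h, z) : hist R n.+1))
  lam S D (lam * m%:R) (expR (lam * m%:R)) m%:R.
apply => //.
- by rewrite -[leLHS]expR0 ler_expR mulr_ge0// ltW.
- exact: measurable_value_next.
- exact: measurable_value_next.
- by move=> z; rewrite value_ge0//= value_le.
- by move=> z; exact: value_ge0.
Qed.

(** If the bin is visited so rarely under [f0] that the exponent stays away from 0, then the cost
    under [f1] is at least of order [T * D]. *)
Lemma total_value_change_of_measure T : (0 < T)%N ->
  ((expR (1 - (T%:R^-1 + S) * fine (total_value f0 b T)))%:E <=
   1 + (expR 1 / (T%:R * D))%:E * total_value f1 g T)%E.
Proof.
(* With [lam] the inverse of the horizon, the increments of all rounds add up to 1. *)
case: T => // T _; set lam : R := T.+1%:R^-1.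
have lam0 : 0 < lam by rewrite invr_gt0.
have lamE : lam * T%:R + lam = 1.
  by rewrite -[X in _ + X]mulr1 -mulrDr natr1 mulVf.
rewrite (_ : expR 1 / (T.+1%:R * D) = expR (lam * T%:R) * expR lam * lam / D);
  last by rewrite -expRD lamE invfM mulrA.
rewrite -[X in expR (X - _)]lamE.
have := @round_change_of_measure R sigma sigma0 (pol_first pi)
  pol_first_setT f0 f1 bin g
  (fun z => @value f0 b T 0 (z : hist R 0))
  (fun z => @value f1 g T 0 (z : hist R 0))
  lam S D (lam * T%:R) (expR (lam * T%:R)) T%:R.
apply => //.
- by rewrite -[leLHS]expR0 ler_expR mulr_ge0// ltW.
- exact: (@measurable_value _ _ T 0).
- exact: (@measurable_value _ _ T 0).
- by move=> z; rewrite value_ge0//= value_le.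
- by move=> z; exact: value_ge0.
- by move=> z; exact: value_change_of_measure.
Qed.

End change_of_measure.
End policy_value.

(** * Hoelder classes *)

Section hoelder_classes.
Context {R : realType}.
Implicit Types (pmin L x : R) (f g : R -> R).

(** For [b > 0] the integer [Num.ceil b - 1] is nonnegative, so [absz] leaves it unchanged. *)
Lemma wdeg_itv (b : R) : 0 < b -> (wdeg b)%:R < b <= (wdeg b).+1%:R.
Proof.
move=> b0; have /andP[h1 h2] := ceil_itv b.
have c1 : (0 <= Num.ceil b - 1)%R by rewrite subr_ge0 -gtz0_ge1 ceil_gt0.
have wE : ((wdeg b)%:R : R) = (Num.ceil b - 1)%:~R.
  by rewrite /wdeg -[in RHS](gez0_abs c1).
by rewrite wE h1/= -natr1 wE rmorphB /= subrK.
Qed.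

Lemma wdeg1 : wdeg (1 : R) = 0%N.
Proof.
have /andP[] := wdeg_itv (@ltr01 R).
by rewrite (ltr_nat R _ 1) ltnS leqn0 => /eqP.
Qed.

(** Identifies an explicit chain of derivatives with the iterated derivatives in which the Hoelder
    classes are stated. *)
Lemma derive1n_eq (F : nat -> R -> R) (w : nat) :
  (forall k, (k < w)%N -> forall x, is_derive x 1 (F k) (F k.+1 x)) ->
  forall k, (k <= w)%N -> derive1n k (F 0%N) = F k.
Proof.
move=> dF; elim=> [|k IH] kw; first by rewrite derive1n0.
rewrite derive1nS IH ?(ltnW kw)//; apply/funext => x.
by rewrite derive1E; have [_ ->] := dF _ kw x.
Qed.

Lemma exprn_le_powR (e r : R) k : 1 <= e -> k%:R <= r -> e ^+ k <= powR e r.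
Proof.
by move=> e1 kr; rewrite -powR_mulrn ?(le_trans ler01)//; exact: ler_powR.
Qed.

Lemma le_powR_id (x r : R) : 0 <= x <= 1 -> r <= 1 -> 0 < r -> x <= powR x r.
Proof.
move=> /andP[]; rewrite le_eqVlt => /orP[/eqP <- _ _ r0|x0 x1 r1 r0].
  by rewrite powR_ge0.
by rewrite -[leLHS](powRr1 (ltW x0)); apply: ger_powR => //; rewrite x0.
Qed.

(* Interpolation between the sup and Lipschitz bounds of the derivative of
   order [wdeg gam], for a function oscillating at frequency [e]. *)
Lemma hoelder0_of_derivs pmin gam L (F : nat -> R -> R) (e D : R) :
  0 < gam -> 1 <= e -> 0 <= D ->
  (forall k, (k <= wdeg gam)%N -> forall x, is_derive x 1 (F k) (F k.+1 x)) ->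
  (forall k, (k <= (wdeg gam).+1)%N -> forall p, p \in `[pmin, 1] ->
    `|F k p| <= D * e ^+ k) ->
  2 * D * powR e gam <= L -> hoelder0 pmin gam L (F 0%N).
Proof.
move=> gam0 e1 D0 dF bF DL; set w := wdeg gam in dF bF *.
have /andP[wg gw] := wdeg_itv gam0.
have e0 : 0 < e by exact: lt_le_trans e1.
have FE k : (k <= w)%N -> derive1n k (F 0%N) = F k.
  by apply: derive1n_eq => j jw; exact: dF (ltnW jw).
have dk k x : (k <= w)%N -> derivable (F k) x 1.
  by move=> kw; have [] := dF k kw x.
have cF k : (k <= w)%N -> continuous (F k).
  by move=> kw x; apply/differentiable_continuous/derivable1_diffP; exact: dk.
have pg : 0 <= powR e gam by exact: powR_ge0.
split; last split; last split.
- by move=> k kw x; rewrite FE ?(ltnW kw)//; exact: dk (ltnW kw).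
- by rewrite FE//; exact: cF.
- move=> k kw p pI; rewrite FE// (le_trans (bF _ _ _ pI)) ?leqW// (le_trans _ DL)//.
  have : e ^+ k <= powR e gam.
    by apply: exprn_le_powR => //; rewrite (le_trans _ (ltW wg))// ler_nat.
  move=> /(ler_wpM2l D0); have : 0 <= D * powR e gam by exact: mulr_ge0.
  lra.
- move=> p p' pI pI'; rewrite FE//.
  wlog pp : p p' pI pI' / p' <= p.
    move=> H; have [|/ltW h] := leP p' p; first exact: H.
    by rewrite distrC [`|p - p'|]distrC; exact: H.
  have lip : `|F w p - F w p'| <= D * e ^+ w * (e * `|p - p'|).
    have [c cI ->] := @MVT_segment R (F w) (F w.+1) p' p pp
      (fun x _ => dF w (leqnn _) x) (continuous_subspaceT (cF w (leqnn _))).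
    rewrite normrM mulrA ler_wpM2r// -mulrA -exprSr; apply: bF => //.
    move: cI pI pI'; rewrite !in_itv/= => /andP[pc cp] /andP[_ p1] /andP[p0 _].
    by rewrite (le_trans p0 pc) (le_trans cp p1).
  have bnd : `|F w p - F w p'| <= 2 * D * e ^+ w.
    rewrite (le_trans (ler_normB _ _))//.
    have := bF w (leqnSn _) p pI; have := bF w (leqnSn _) p' pI'; lra.
  set t := `|p - p'| in lip *; have t0 : 0 <= t by exact: normr_ge0.
  set eta := gam - w%:R.
  have eta0 : 0 < eta by rewrite subr_gt0.
  have eta1 : eta <= 1 by rewrite lerBlDl natr1.
  have et0 : 0 <= e * t by rewrite mulr_ge0// ltW.
  have Dw : 0 <= D * e ^+ w by rewrite mulr_ge0// exprn_ge0// ltW.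
  (* The Lipschitz bound is used for [e * t <= 1], the sup bound beyond; each lies below the power
     since [0 < eta <= 1]. *)
  have key : `|F w p - F w p'| <= 2 * D * e ^+ w * powR (e * t) eta.
    have [et1|et1] := leP (e * t) 1.
      have h : e * t <= powR (e * t) eta by apply: le_powR_id => //; rewrite et0.
      apply: (le_trans lip); have := ler_wpM2l Dw h.
      have := mulr_ge0 Dw (powR_ge0 (e * t) eta); lra.
    apply: (le_trans bnd); rewrite ler_peMr//.
      by have := Dw; lra.
    by rewrite -[leLHS](powRr0 (e * t)) ler_powR ?ltW.
  apply: (le_trans key); rewrite (powRM eta (ltW e0) t0) mulrA.
  apply: ler_wpM2r; first exact: powR_ge0.
  apply: le_trans DL; rewrite -(powR_mulrn w (ltW e0)) -mulrA -powRD.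
    by rewrite subrKC.
  by apply/implyP => _; rewrite gt_eqF.
Qed.

Lemma hoelder0D pmin gam L1 L2 f g :
  hoelder0 pmin gam L1 f -> hoelder0 pmin gam L2 g ->
  hoelder0 pmin gam (L1 + L2) (fun x => f x + g x).
Proof.
rewrite /hoelder0; set w := wdeg gam.
move=> [df [cf [bf hf]]] [dg [cg [bg hg]]].
have E k : (k <= w)%N ->
    derive1n k (fun x => f x + g x) = (fun x => derive1n k f x + derive1n k g x).
  elim: k => [|k IH] kw; first by rewrite !derive1n0.
  rewrite derive1nS IH ?(ltnW kw)//; apply/funext => x.
  rewrite !derive1nS !derive1E.
  by rewrite (deriveD (df _ kw x) (dg _ kw x)).
split; last split; last split.
- move=> k kw x; rewrite E ?(ltnW kw)//.
  exact: (derivableD (df _ kw x) (dg _ kw x)).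
- by rewrite E// => x; apply: cvgD; [exact: cf|exact: cg].
- move=> k kw p pI; rewrite E// (le_trans (ler_normD _ _))// lerD//.
    exact: bf.
  exact: bg.
- move=> p p' pI pI'; rewrite E// opprD addrACA (le_trans (ler_normD _ _))//.
  by rewrite mulrDl lerD//; [exact: hf|exact: hg].
Qed.

Lemma hoelderD pmin gam L1 L2 f g :
  Defs.hoelder pmin gam L1 f -> Defs.hoelder pmin gam L2 g ->
  Defs.hoelder pmin gam (L1 + L2) (fun x => f x + g x).
Proof.
move=> [h1 k1] [h2 k2]; split; first exact: hoelder0D.
by move=> g1; apply: hoelder0D; [exact: k1|exact: k2].
Qed.

Definition coef_norm (P : {poly R}) : R := \sum_(i < size P) `|P`_i|.

Lemma coef_norm_ge0 P : 0 <= coef_norm P.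
Proof. by apply: sumr_ge0 => i _; exact: normr_ge0. Qed.

Lemma horner_le_coef_norm (P : {poly R}) x :
  0 <= x <= 1 -> `|P.[x]| <= coef_norm P.
Proof.
move=> /andP[x0 x1]; rewrite horner_coef (le_trans (ler_norm_sum _ _ _))//.
apply: ler_sum => i _; rewrite normrM ler_piMr//.
by rewrite ger0_norm ?exprn_ge0// exprn_ile1.
Qed.

Lemma is_derive_pospow m (x : R) :
  is_derive x 1 (fun z => Num.max 0 z ^+ m.+2) (m.+2%:R * Num.max 0 x ^+ m.+1).
Proof.
have [x0|x0|->] := ltgtP x 0.
- rewrite expr0n/= mulr0.
  have := is_derive_cst (0 : R) x (1 : R); apply: near_eq_is_derive.
  near=> z; rewrite /= max_l ?expr0n//.
  apply: ltW; near: z; exact: lt_nbhsl.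
- have : is_derive x 1 (fun z : R => z ^+ m.+2) (m.+2%:R * x ^+ m.+1).
    rewrite (_ : (fun z : R => _) = horner 'X^(m.+2)); last first.
      by apply/funext => z; rewrite hornerXn.
    have := is_derive_poly ('X^(m.+2) : {poly R}) x.
    by rewrite derivXn hornerMn hornerXn mulr_natl.
  apply: near_eq_is_derive.
  near=> z; rewrite /= max_r//.
  apply: ltW; near: z; exact: lt_nbhsr.
- rewrite expr0n/= mulr0.
  (* At the kink the difference quotient extends to a continuous function vanishing at 0. *)
  apply/is_derive1_caratheodory; exists (fun z => Num.max 0 z ^+ m.+1); split.
  + move=> z; rewrite maxxx expr0n/= !subr0.
    have [z0|z0] := leP 0 z; last by rewrite !expr0n mul0r.
    by rewrite -exprSr.
  + have cm : {for (0 : R), continuous (fun z : R => Num.max 0 z)}.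
      rewrite (_ : (fun z : R => _) = (fun z : R => (0 + z + `|0 - z|) / 2)).
        apply: cvgM; last exact: cvg_cst.
        apply: cvgD; first by apply: cvgD; [exact: cvg_cst|exact: cvg_id].
        by apply: cvg_norm; apply: cvgB; [exact: cvg_cst|exact: cvg_id].
      by apply/funext => z; rewrite maxr_absE.
    exact: (continuous_comp cm (@exprn_continuous R m.+1 _)).
  + by rewrite maxxx expr0n.
Unshelve. all: by end_near. Qed.

End hoelder_classes.

(** * Flat base demand and smooth bumps *)

Section base_and_bump.
Context {R : realType}.
Implicit Types (pmin L x : R) (P : {poly R}).

Lemma hoelder0_poly pmin gam L P : 0 < gam -> 0 < L -> 0 <= pmin ->
  exists2 c0 : R, 0 < c0 &
    forall c, 0 <= c <= c0 -> hoelder0 pmin gam L (fun x => c * P.[x]).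
Proof.
move=> gam0 L0 pmin0; set w := wdeg gam.
pose K : R := \sum_(k < w.+2) coef_norm P^`(k).
have K0 : 0 <= K by apply: sumr_ge0 => k _; exact: coef_norm_ge0.
(* From [2 * (c * K) <= L], at frequency 1; the [+ 1] keeps the denominator positive. *)
exists (L / (2 * (K + 1))); first by rewrite divr_gt0// mulr_gt0// ltr_wpDl.
move=> c /andP[c0 cL].
pose F k x := (c *: P^`(k)).[x].
have -> : (fun x => c * P.[x]) = F 0%N by apply/funext => x; rewrite /F hornerZ.
apply: (@hoelder0_of_derivs _ _ _ _ _ 1 (c * K)) => //.
- exact: mulr_ge0.
- move=> k kw x; rewrite /F derivnS -derivZ; exact: is_derive_poly.
- move=> k kw p; rewrite in_itv/= => /andP[p0 p1].
  rewrite expr1n mulr1 /F hornerZ normrM (ger0_norm c0) ler_wpM2l//.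
  apply: (le_trans (horner_le_coef_norm _ _)).
    by rewrite p1 (le_trans pmin0).
  rewrite /K (bigD1 (Ordinal (kw : (k < w.+2)%N)))//= lerDl.
  by apply: sumr_ge0 => i _; exact: coef_norm_ge0.
- rewrite powR1 mulr1; have K1 : 0 < K + 1 by rewrite ltr_wpDl.
  move: cL; rewrite ler_pdivlMr ?mulr_gt0//; lra.
Qed.

(** Valid for all small [c], so that one scale can serve two classes at once. *)
Lemma hoelder_poly pmin gam L P : 0 < gam -> 0 < L -> 0 <= pmin ->
  exists2 c0 : R, 0 < c0 &
    forall c, 0 <= c <= c0 -> Defs.hoelder pmin gam L (fun x => c * P.[x]).
Proof.
move=> gam0 L0 pmin0.
have [c1 c10 h1] := hoelder0_poly P gam0 L0 pmin0.
have [c2 c20 h2] := hoelder0_poly P (@ltr01 R) L0 pmin0.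
exists (Num.min c1 c2); first by rewrite lt_min c10.
move=> c /andP[c0]; rewrite le_min => /andP[cc1 cc2]; split=> [|_].
  by apply: h1; rewrite c0.
by apply: h2; rewrite c0.
Qed.

(* The family [P(y) * max(0, y (1-y))^m] is stable under derivation, which
   lowers [m] by one. *)
Definition bump_term P (m : nat) (y : R) : R :=
  P.[y] * Num.max 0 (y * (1 - y)) ^+ m.

(** With [q = y * (1 - y)], the product rule for [P * q ^+ m.+2] after taking out [q ^+ m.+1]. *)
Definition bump_deriv (m : nat) P : {poly R} :=
  P^`() * ('X * (1 - 'X)) + m.+2%:R *: (P * (1 - 2%:R *: 'X)).

Lemma is_derive_bump_term P m (y : R) :
  is_derive y 1 (bump_term P m.+2) (bump_term (bump_deriv m P) m.+1 y).
Proof.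
have dq : is_derive y 1 (fun z : R => z * (1 - z)) (1 - 2 * y).
  rewrite (_ : (fun z : R => _) = horner ('X * (1 - 'X))); last first.
    by apply/funext => z; rewrite !hornerE.
  have := is_derive_poly ('X * (1 - 'X) : {poly R}) y.
  rewrite derivM derivB derivX derivC; rewrite !hornerE.
  by move=> /is_derive_eq; apply; ring.
have dm := @is_derive1_comp R (fun z => Num.max 0 z ^+ m.+2)
  (fun z => z * (1 - z)) y _ _ (is_derive_pospow m (y * (1 - y))) dq.
have := is_deriveM (is_derive_poly P y) dm.
move=> /is_derive_eq; apply.
rewrite /bump_term /bump_deriv !hornerE /= !scalerAl /GRing.scale/=.
set M := Num.max _ _.
have -> : M ^+ m.+2 = y * (1 - y) * M ^+ m.+1.
  rewrite exprS /M; have [h|h] := leP 0 (y * (1 - y)) => //.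
  by rewrite expr0n/= !mulr0.
ring.
Qed.

(** Off [[0, 1]] the positive part is 0, and so is its power, the exponent being positive. *)
Lemma bump_term_le P m (y : R) : `|bump_term P m.+1 y| <= coef_norm P.
Proof.
rewrite /bump_term normrM.
have [y01|] := boolP (0 <= y <= 1).
  have /andP[y0 y1] := y01.
  apply: le_trans (horner_le_coef_norm P y01); rewrite ler_piMr//.
  rewrite max_r ?mulr_ge0 ?subr_ge0// ger0_norm ?exprn_ge0 ?mulr_ge0 ?subr_ge0//.
  rewrite exprn_ile1 ?mulr_ge0 ?subr_ge0//; nra.
move=> y01; rewrite max_l; last first.
  move: y01; rewrite negb_and -!ltNge => /orP[]; nra.
by rewrite expr0n/= normr0 mulr0 coef_norm_ge0.
Qed.

(** Polynomial factor of the derivative of order [k] of the bump. The initial constant normalizes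
    the maximum, reached where [y * (1 - y)] is [1 / 4], to 1. *)
Fixpoint bump_poly (w k : nat) : {poly R} :=
  match k with
  | 0 => (4 ^+ w.+2)%:P
  | k'.+1 => bump_deriv (w - k') (bump_poly w k')
  end.

(** The exponent [w.+2] leaves one factor of the positive part after [w.+1] derivatives, the highest
    order that the Hoelder bound uses. *)
Definition smooth_bump (w : nat) : R -> R := bump_term (bump_poly w 0) w.+2.

Definition bump_derivs (w : nat) (H e a : R) (k : nat) (x : R) : R :=
  H * e ^+ k * bump_term (bump_poly w k) (w.+2 - k) (e * (x - a)).

Lemma is_derive_bump_derivs w H e a k (x : R) : (k <= w)%N ->
  is_derive x 1 (bump_derivs w H e a k) (bump_derivs w H e a k.+1 x).
Proof.
move=> kw; rewrite /bump_derivs subSS.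
have -> : (w.+2 - k = (w - k).+2)%N by rewrite !subSn// ltnW.
have -> : (w.+1 - k = (w - k).+1)%N by rewrite subSn.
have da : is_derive x 1 (fun x : R => e * (x - a)) e.
  rewrite (_ : (fun z : R => _) = horner (e *: ('X - a%:P))); last first.
    by apply/funext => z; rewrite !hornerE.
  have := is_derive_poly (e *: ('X - a%:P) : {poly R}) x.
  by rewrite derivZ derivB derivX derivC subr0 !hornerE.
have d1 := @is_derive1_comp R (bump_term (bump_poly w k) (w - k).+2)
  (fun x => e * (x - a)) x _ _
  (is_derive_bump_term (bump_poly w k) (w - k) (e * (x - a))) da.
have := is_deriveZ (H * e ^+ k) d1.
move=> /is_derive_eq; apply; rewrite /GRing.scale/= exprS; ring.
Qed.

Definition bump_bound (w : nat) : R :=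
  \sum_(k < w.+2) coef_norm (bump_poly w k).

Lemma bump_derivs_le w H e a k (x : R) : 0 <= H -> 0 <= e -> (k <= w.+1)%N ->
  `|bump_derivs w H e a k x| <= H * bump_bound w * e ^+ k.
Proof.
move=> H0 e0 kw; rewrite /bump_derivs.
have : `|bump_term (bump_poly w k) (w.+2 - k) (e * (x - a))| <= bump_bound w.
  have -> : (w.+2 - k = (w.+1 - k).+1)%N by rewrite subSn.
  apply: (le_trans (bump_term_le _ _ _)).
  rewrite /bump_bound (bigD1 (Ordinal (kw : (k < w.+2)%N)))//= lerDl.
  by apply: sumr_ge0 => i _; exact: coef_norm_ge0.
move: (bump_term _ _ _) => b hb.
rewrite normrM mulrAC ger0_norm ?mulr_ge0 ?exprn_ge0//.
by rewrite ler_wpM2l// mulr_ge0// exprn_ge0.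
Qed.

Lemma bump_bound_ge0 w : 0 <= bump_bound w.
Proof. by apply: sumr_ge0 => i _; exact: coef_norm_ge0. Qed.

Lemma bump_derivs0 w H e a :
  bump_derivs w H e a 0 = (fun x => H * smooth_bump w (e * (x - a))).
Proof. by apply/funext => x; rewrite /bump_derivs expr0 mulr1 subn0. Qed.

(** Each derivative costs a factor [e], so smoothness [gam] restricts the height to order
    [e^(- gam)]. *)
Lemma hoelder_bump pmin gam L (H e a : R) : 0 < gam -> 1 <= e -> 0 <= H ->
  2 * (H * bump_bound (wdeg gam)) * powR e gam <= L ->
  Defs.hoelder pmin gam L (fun x => H * smooth_bump (wdeg gam) (e * (x - a))).
Proof.
move=> gam0 e1 H0 HL; have e0 : 0 <= e by exact: le_trans e1.
have HB : 0 <= H * bump_bound (wdeg gam) by rewrite mulr_ge0// bump_bound_ge0.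
rewrite -bump_derivs0; split=> [|gam1].
  apply: (@hoelder0_of_derivs R pmin gam L (bump_derivs (wdeg gam) H e a) e
    (H * bump_bound (wdeg gam)) gam0 e1 HB _ _ HL).
    by move=> k kw x; exact: is_derive_bump_derivs.
  by move=> k kw p _; exact: bump_derivs_le.
apply: (@hoelder0_of_derivs R pmin 1 L (bump_derivs (wdeg gam) H e a) e
    (H * bump_bound (wdeg gam)) ltr01 e1 HB).
- move=> k; rewrite wdeg1 => k0 x; apply: is_derive_bump_derivs.
  exact: leq_trans k0 _.
- move=> k; rewrite wdeg1 => k0 p _; apply: bump_derivs_le => //.
  exact: leq_trans k0 _.
(* For [gam >= 1] and [e >= 1] the Lipschitz condition is the weaker one. *)
- apply: le_trans HL; rewrite ler_wpM2l//; last exact: ler_powR.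
  by rewrite mulr_ge0.
Qed.

Lemma bump_half w : smooth_bump w (2^-1) = 1.
Proof.
rewrite /smooth_bump /bump_term /= hornerC.
have -> : 2^-1 * (1 - 2^-1) = 4^-1 :> R by field.
by rewrite max_r ?invr_ge0// exprVn divff// expf_neq0.
Qed.

Lemma bump_ge0 w (y : R) : 0 <= smooth_bump w y.
Proof.
by rewrite /smooth_bump /bump_term /= hornerC mulr_ge0 ?exprn_ge0// le_max lexx.
Qed.

Lemma bump_le1 w (y : R) : smooth_bump w y <= 1.
Proof.
rewrite /smooth_bump /bump_term /= hornerC -exprMn exprn_ile1//.
  by rewrite mulr_ge0// le_max lexx.
rewrite -ler_pdivlMl// mulr1 ge_max invr_ge0 ler0n/=.
have := sqr_ge0 (y - 2^-1); rewrite sqrrB exprVn; lra.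
Qed.

(** The bump vanishes at 1 as well, which permits half-open, hence disjoint, bins. *)
Lemma bump_out w (y : R) : ~~ (0 <= y < 1) -> smooth_bump w y = 0.
Proof.
move=> y01; rewrite /smooth_bump /bump_term max_l ?expr0n ?mulr0//.
move: y01; rewrite negb_and -ltNge -leNgt => /orP[]; nra.
Qed.

Lemma continuous_bump w : continuous (smooth_bump w).
Proof.
move=> y; apply/differentiable_continuous/derivable1_diffP.
by have [] := is_derive_bump_term (bump_poly w 0) w y.
Qed.

(* With [n] terms of the geometric series, [x * flat n x = 1 - (1 - x)^n]: the
   revenue is flat up to order [n] at the optimal price [1]. *)
Definition flat (n : nat) : {poly R} := \sum_(i < n) (1 - 'X) ^+ i.

Lemma flatE n (x : R) : x * (flat n).[x] = 1 - (1 - x) ^+ n.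
Proof.
have -> : (flat n).[x] = \sum_(i < n) (1 - x) ^+ i.
  by rewrite horner_sum; apply: eq_bigr => i _; rewrite !hornerE.
by rewrite -[RHS]opprB subrX1; ring.
Qed.

End base_and_bump.

(** * Base and bumped demands *)

Section two_instances.
Context {R : realType}.
Variables (pmin sigma : R).
Hypotheses (pmin0 : 0 < pmin) (pmin1 : pmin < 1) (sigma0 : 0 < sigma).

(** The bound [B] ensures that the supremum in [gap] is an upper bound of the revenues. *)
Lemma gap_ge f (B p q : R) : (forall x, x \in `[pmin, 1] -> x * f x <= B) ->
  q \in `[pmin, 1] -> q * f q - p * f p <= gap pmin f p.
Proof.
move=> fB qI; rewrite /gap lerD2r; apply: ub_le_sup.
  by exists B => _ [x xI <-]; exact: fB.
by exists q.
Qed.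

(* The value off [pmin, 1], where no price is set, makes the lower bounds on the
   cost hold for every real [p]. *)
Definition gap_cost (f : R -> R) (D p : R) : \bar R :=
  (gap pmin f p * \1_`[pmin, 1]%classic p +
   D * (1 - \1_`[pmin, 1]%classic p))%:E.

Lemma gap_cost_in f D p : p \in `[pmin, 1] -> gap_cost f D p = (gap pmin f p)%:E.
Proof.
by move=> pI; rewrite /gap_cost indicE mem_set//= mulr1 subrr mulr0 addr0.
Qed.

Lemma gap_cost_out f D p : p \notin `[pmin, 1] -> gap_cost f D p = D%:E.
Proof.
move=> pI; rewrite /gap_cost indicE memNset ?mulr0 ?subr0 ?mulr1 ?add0r//.
exact/negP.
Qed.

Lemma measurable_gap_cost f D : measurable_fun setT f ->
  measurable_fun setT (gap_cost f D).
Proof.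
move=> mf; apply/measurable_EFinP.
have mi : measurable_fun setT (\1_`[pmin, 1]%classic : R -> R).
  exact: measurable_indic.
apply: measurable_funD; last first.
  by apply: measurable_funM => //; exact: measurable_funB.
apply: measurable_funM => //; apply: measurable_funB => //.
exact: measurable_funM.
Qed.

Lemma gap_cost_ge0 f (B D p : R) : 0 <= D ->
  (forall x, x \in `[pmin, 1] -> x * f x <= B) -> (0 <= gap_cost f D p)%E.
Proof.
move=> D0 fB; have [pI|pI] := boolP (p \in `[pmin, 1]); last first.
  by rewrite gap_cost_out.
by rewrite gap_cost_in// lee_fin; have := gap_ge p fB pI; rewrite subrr.
Qed.

Variables (n M w : nat) (c u : R).
Hypotheses (n0 : (0 < n)%N) (M0 : (0 < M)%N) (c0 : 0 < c) (u0 : 0 < u).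
Hypothesis u_le : 2 * u <= 1 - pmin.

(** [D] is the base loss at the price [1 - u], a lower bound for the loss in every bin. [pmin * H]
    is twice the base loss at [1 - 2 * u], so a bump of height [H] overcompensates the loss in any
    bin. The bins have width [e^-1] and left ends [a j]. *)
Let D : R := c * u ^+ n.
Let H : R := 2 * c * (2 * u) ^+ n / pmin.
Let e : R := M%:R / u.
Let a (j : nat) : R := 1 - 2 * u + j%:R / e.

Definition base_demand (x : R) : R := c * (flat n).[x].

Definition bumped_demand (j : nat) (x : R) : R :=
  base_demand x + H * smooth_bump w (e * (x - a j)).

Let bin (j : nat) : set R := `[a j, a j + e^-1[%classic.

Let e0 : 0 < e. Proof. by rewrite divr_gt0// ltr0n. Qed.
Let D0 : 0 < D. Proof. by rewrite mulr_gt0// exprn_gt0. Qed.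
Let uu0 : 0 < (2 * u) ^+ n. Proof. by rewrite exprn_gt0// mulr_gt0. Qed.
Let H0 : 0 < H. Proof. by rewrite divr_gt0// mulr_gt0// mulr_gt0. Qed.

Let base_revenue x : x * base_demand x = c - c * (1 - x) ^+ n.
Proof. by rewrite /base_demand mulrCA flatE mulrBr mulr1. Qed.

Let base_revenue_le x : x \in `[pmin, 1] -> x * base_demand x <= c.
Proof.
rewrite in_itv/= => /andP[_ x1]; rewrite base_revenue gerBl.
by rewrite mulr_ge0 ?(ltW c0)// exprn_ge0// subr_ge0.
Qed.

Let binP j x : (bin j x) <-> (0 <= e * (x - a j) < 1).
Proof.
rewrite /bin/= in_itv/=; rewrite -subr_ge0 -(pmulr_rge0 (x - a j) e0).
by rewrite -ltrBlDl -(ltr_pM2l e0) divff ?gt_eqF.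
Qed.

Let binE j x : e * (x - a j) = e * (x - (1 - 2 * u)) - j%:R.
Proof. by rewrite /a; field; rewrite gt_eqF. Qed.

(** The index is the integer part of [e * (x - (1 - 2 * u))]. *)
Let bin_uniq i j x : bin i x -> bin j x -> i = j.
Proof.
have lt k l : bin k x -> bin l x -> (k <= l)%N.
  move=> /binP + /binP; rewrite !binE => /andP[h1 h2] /andP[h3 h4].
  rewrite -ltnS -(ltr_nat R) -natr1; lra.
by move=> bi bj; apply/eqP; rewrite eqn_leq !lt.
Qed.

Let bin_sub j x : (j < M)%N -> bin j x -> 1 - 2 * u <= x <= 1 - u.
Proof.
move=> jM /binP; rewrite binE => /andP[h1 h2].
have h3 : 0 <= e * (x - (1 - 2 * u)) by have := ler0n R j; lra.
have : 0 <= x - (1 - 2 * u) by rewrite pmulr_rge0 in h3.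
have : e * (x - (1 - 2 * u)) <= M%:R.
  have : j%:R + 1 <= M%:R :> R by rewrite natr1 ler_nat.
  lra.
rewrite -ler_pdivlMl// (_ : e^-1 * M%:R = u); first lra.
by rewrite /e invfM invrK mulrC mulVKf// pnatr_eq0 -lt0n.
Qed.

Let bin_price j x : (j < M)%N -> bin j x -> x \in `[pmin, 1].
Proof.
move=> jM /(bin_sub jM) /andP[h1 h2]; rewrite in_itv/=.
by apply/andP; split; have := u_le; have := u0; lra.
Qed.

(** Compared with the price 1, the loss is [c * (1 - x) ^+ n], and [x <= 1 - u] in every bin. *)
Let base_gap j x : (j < M)%N -> bin j x -> D <= gap pmin base_demand x.
Proof.
move=> jM bx; have /andP[_ xu] := bin_sub jM bx.
have I1 : 1 \in `[pmin, 1] by rewrite in_itv/= lexx ltW.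
apply: le_trans (gap_ge x base_revenue_le I1).
rewrite !base_revenue subrr expr0n eqn0Ngt n0/= mulr0 subr0 opprB addrCA subrr addr0.
rewrite ler_pM2l// lerXn2r ?nnegrE ?(ltW u0)//; have := u0; lra.
Qed.

Let bump_in_bin j x : ~ bin j x -> smooth_bump w (e * (x - a j)) = 0.
Proof. by move=> nb; apply: bump_out; apply/negP => /binP. Qed.

Let bumped_out j x : ~ bin j x -> bumped_demand j x = base_demand x.
Proof. by move=> nb; rewrite /bumped_demand bump_in_bin// mulr0 addr0. Qed.

Let bumped_revenue_le j x : x \in `[pmin, 1] -> x * bumped_demand j x <= c + H.
Proof.
move=> xI; rewrite mulrDr lerD ?base_revenue_le//.
move: xI; rewrite in_itv/= => /andP[x0 x1].
have b0 := bump_ge0 w (e * (x - a j)); have b1 := bump_le1 w (e * (x - a j)).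
rewrite mulrCA ler_piMr ?(ltW H0)// -[leRHS]mulr1 ler_pM//.
by rewrite (le_trans _ x0)// ltW.
Qed.

(** At the midpoint [q] the bump equals 1 and the revenue is at least
    [c - c * (2 * u) ^+ n + pmin * H], that is, [c + c * (2 * u) ^+ n]. A price outside the bin
    earns at most [c]. *)
Let bumped_gap j x : (j < M)%N -> x \in `[pmin, 1] -> ~ bin j x ->
  D <= gap pmin (bumped_demand j) x.
Proof.
move=> jM xI nb.
pose q := a j + (2 * e)^-1.
have eq : e * (q - a j) = 2^-1.
  by rewrite /q [a j + _]addrC addrK invfM mulrCA divff ?mulr1// gt_eqF.
have bq : bin j q by apply/binP; rewrite eq; apply/andP; split; lra.
have qI := bin_price jM bq.
have /andP[q1 q2] := bin_sub jM bq.
have pq : pmin <= q by move: qI; rewrite in_itv/= => /andP[].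
apply: le_trans (gap_ge x (@bumped_revenue_le j) qI).
have -> : x * bumped_demand j x = x * base_demand x by rewrite bumped_out.
rewrite mulrDr base_revenue eq bump_half mulr1.
have := base_revenue_le xI.
have h1 : (1 - q) ^+ n <= (2 * u) ^+ n by rewrite lerXn2r ?nnegrE; have := u0; lra.
have h2 : u ^+ n <= (2 * u) ^+ n by rewrite lerXn2r ?nnegrE; have := u0; lra.
have h3 : pmin * H = 2 * (c * (2 * u) ^+ n).
  by rewrite /H; field; rewrite gt_eqF.
have h4 : pmin * H <= q * H by rewrite ler_pM2r.
have := ler_wpM2l (ltW c0) h1; have := ler_wpM2l (ltW c0) h2.
rewrite -/D; lra.
Qed.

Lemma measurable_base_demand : measurable_fun setT base_demand.
Proof.
apply: measurable_funM => //; apply: continuous_measurable_fun.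
exact: continuous_horner.
Qed.

Lemma measurable_bumped_demand j : measurable_fun setT (bumped_demand j).
Proof.
apply: measurable_funD; first exact: measurable_base_demand.
apply: measurable_funM => //; apply: measurableT_comp => //.
  by apply: continuous_measurable_fun; exact: continuous_bump.
by apply: measurable_funM => //; exact: measurable_funB.
Qed.

Let bins_cost x :
  (\sum_(j < M) D%:E * (\1_(bin j) x)%:E <= gap_cost base_demand D x)%E.
Proof.
have [[j bj]|nb] := pselect (exists j : 'I_M, bin j x); last first.
  rewrite big1; first exact: (gap_cost_ge0 _ (ltW D0) base_revenue_le).
  move=> j _; rewrite indicE memNset ?mule0// => bj.
  by apply: nb; exists j.
rewrite (bigD1 j)//= big1 ?adde0; last first.
  move=> i ij; rewrite indicE memNset ?mule0// => bi.
  by move/eqP: ij; apply; apply/val_inj; exact: bin_uniq bi bj.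
rewrite indicE mem_set//= mule1 gap_cost_in; last exact: bin_price bj.
by rewrite lee_fin; exact: base_gap bj.
Qed.

(* Some bin receives few prices under the base demand; a bump in that bin then
   goes unnoticed. *)
Lemma regret_tradeoff (pi : policy pmin) (T : nat) (r : R) : (0 < T)%N ->
  (regret sigma base_demand pi T <= r%:E)%E ->
  (T%:R^-1 + H ^+ 2 / sigma ^+ 2) * r <= D * M%:R / 2 ->
  exists2 j, (j < M)%N &
    ((T%:R * D / (2 * expR 1))%:E <= regret sigma (bumped_demand j) pi T)%E.
Proof.
move=> T0 hr hrM.
have s0 : sigma != 0 by rewrite gt_eqF.
have mb := measurable_base_demand.
have mbin j : measurable (bin j) by exact: measurable_itv.
pose b j x : \bar R := (\1_(bin j) x)%:E.
have mbb j : measurable_fun setT (b j).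
  by apply/measurable_EFinP; exact: measurable_indic.
have b0 j x : (0 <= b j x)%E.
  by rewrite lee_fin indicE; case: (_ \in _); rewrite ?ler01.
have b1 j x : (b j x <= 1)%E.
  by rewrite lee_fin indicE; case: (_ \in _); rewrite ?ler01.
pose V j := total_value sigma pi base_demand (b j) T.
have V0 j : (0 <= V j)%E by exact: total_value_ge0.
have VT j : (V j <= T%:R%:E)%E by exact: total_value_le.
have Vfin j : V j = (fine (V j))%:E.
  by rewrite fineK// ge0_fin_numE//; exact: le_lt_trans (VT j) (ltry _).
have N0 j : 0 <= fine (V j) by rewrite fine_ge0.
(* Every visit to a bin costs at least [D] under the base demand. *)
have sumN : \sum_(j < M) D * fine (V j) <= r.
  rewrite -lee_fin -sumEFin; apply: le_trans hr.
  rewrite (@regret_value _ _ _ pi s0 _ (gap_cost base_demand D))//; last 3 first.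
  - exact: measurable_gap_cost.
  - by move=> p; exact: (gap_cost_ge0 _ (ltW D0) base_revenue_le).
  - by move=> p; exact: gap_cost_in.
  under eq_bigr do rewrite EFinM -Vfin -total_valueZ ?(ltW D0)//.
  apply: sum_total_value => //.
  - by move=> j; exact: measurable_funeM.
  - exact: measurable_gap_cost.
  - by move=> j p; rewrite mule_ge0// lee_fin ltW.
have MR : 0 < M%:R :> R by rewrite ltr0n.
(* Pigeonhole: some bin has at most the average number of visits. *)
have [j Nj] : exists j : 'I_M, D * M%:R * fine (V j) <= r.
  apply/existsP; apply: contraLR sumN; rewrite negb_exists -ltNge => /forallP h.
  have -> : r = \sum_(j < M) (r / M%:R).
    by rewrite sumr_const card_ord -[RHS]mulr_natr divfK ?gt_eqF.
  apply: ltr_sum => [|j _].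
    by apply/hasP; exists (Ordinal M0) => //; rewrite mem_index_enum.
  by rewrite ltr_pdivrMr// mulrAC ltNge; exact: h.
exists j => //.
pose S := H ^+ 2 / sigma ^+ 2.
have S0 : 0 <= S by rewrite divr_ge0 ?sqr_ge0.
have mj := measurable_bumped_demand j.
have gD p : ~ bin j p -> (D%:E <= gap_cost (bumped_demand j) D p)%E.
  move=> nb; have [pI|pI] := boolP (p \in `[pmin, 1]); last by rewrite gap_cost_out.
  by rewrite gap_cost_in// lee_fin; exact: bumped_gap.
have fS p : (bumped_demand j p - base_demand p) ^+ 2 / sigma ^+ 2 <= S.
  rewrite /S ler_pM2r ?invr_gt0 ?exprn_gt0//.
  rewrite /bumped_demand [base_demand p + _]addrC addrK exprMn ler_piMr ?sqr_ge0//.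
  by rewrite exprn_ile1 ?bump_ge0 ?bump_le1.
have := @total_value_change_of_measure R pmin sigma pi s0 base_demand
  (bumped_demand j) (bin j) (gap_cost (bumped_demand j) D) S D S0 D0
  (mbin j) mb mj (measurable_gap_cost _ mj)
  (fun p => gap_cost_ge0 p (ltW D0) (@bumped_revenue_le j))
  gD (@bumped_out j) fS T T0.
rewrite -(@regret_value _ _ _ pi s0 _ (gap_cost (bumped_demand j) D))//; last 3 first.
- exact: measurable_gap_cost.
- by move=> p; exact: (gap_cost_ge0 _ (ltW D0) (@bumped_revenue_le j)).
- by move=> p; exact: gap_cost_in.
move=> main.
have TR : 0 < T%:R :> R by rewrite ltr0n.
have half : (T%:R^-1 + S) * fine (V j) <= 1 / 2.
  have TS : 0 <= T%:R^-1 + S by rewrite addr_ge0// invr_ge0 ltW.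
  have DM : 0 < D * M%:R by rewrite mulr_gt0.
  rewrite -(ler_pM2l DM) mulrCA.
  apply: le_trans (ler_wpM2l TS Nj) _.
  by apply: le_trans hrM _; rewrite mul1r.
have e10 : 0 < expR (1 : R) by exact: expR_gt0.
have TD : 0 < T%:R * D by rewrite mulr_gt0.
(* By [half] the exponent is at least [1 / 2], so the exponential is at least [1 + 1 / 2]; the 1
   cancels. *)
have {main} : ((1 / 2)%:E <= (expR 1 / (T%:R * D))%:E *
    regret sigma (bumped_demand j) pi T)%E.
  rewrite -(leeD2lE (x := 1%E))//; apply: le_trans main.
  rewrite -EFinD lee_fin; apply: le_trans (expR_ge1Dx _).
  by move: half; rewrite /V; lra.
have k0 : 0 < expR 1 / (T%:R * D) by rewrite divr_gt0.
rewrite muleC -lee_pdivrMr// -EFinM; apply: le_trans.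
rewrite lee_fin (_ : T%:R * D / (2 * expR 1) = 1 / 2 / (expR 1 / (T%:R * D)))//.
by field; rewrite ?gt_eqF.
Qed.

End two_instances.

(** * Choice of the parameters *)

Section asymptotics.
Context {R : realType}.

Lemma powR_unbounded (K a : R) : 0 < a ->
  exists T0 : nat, forall T : nat, (T0 <= T)%N -> K <= powR T%:R a.
Proof.
move=> a0; pose K' := Num.max K 1.
have K'1 : 1 <= K' by rewrite le_max lexx orbT.
have K'0 : 0 < K' by exact: lt_le_trans K'1.
exists (Num.truncn (powR K' a^-1)).+1 => T hT.
have h : powR K' a^-1 <= T%:R.
  by apply: ltW; apply: lt_le_trans (truncnS_gt _) _; rewrite ler_nat.
apply: (@le_trans _ _ K'); first by rewrite le_max lexx.
rewrite (_ : K' = powR (powR K' a^-1) a); last first.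
  by rewrite -powRrM mulVf ?lt0r_neq0// powRr1// ltW.
by apply: ge0_ler_powR; rewrite ?nnegrE ?powR_ge0 ?(ltW a0).
Qed.

Lemma ln_le_powR (x eta : R) : 0 < x -> 0 < eta -> ln x <= powR x eta / eta.
Proof.
move=> x0 eta0; rewrite ler_pdivlMr// mulrC -ln_powR.
have p0 : 0 < powR x eta by rewrite powR_gt0.
by apply: ltW; exact: ln_sublinear.
Qed.

Lemma polylog_le_powR (K a : R) (k : nat) : 0 < a ->
  exists T0 : nat, forall T : nat, (T0 <= T)%N ->
    K * ln T%:R ^+ k <= powR T%:R a.
Proof.
(* The exponent is cut into [k.+1] equal shares: one absorbs [K], the others one logarithm each. *)
move=> a0; pose eta := a / k.+1%:R.
have eta0 : 0 < eta by rewrite divr_gt0.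
have [T0 hT0] := powR_unbounded (`|K| / eta ^+ k) eta0.
exists T0.+1 => T hT.
have T1 : (0 < T)%N by exact: leq_trans hT.
have TR : 0 < T%:R :> R by rewrite ltr0n.
have ln0 : 0 <= ln (T%:R : R) by rewrite ln_ge0// ler1n.
have -> : a = eta + eta * k%:R.
  by rewrite -[X in X + _]mulr1 -mulrDr addrC natr1 divfK.
rewrite powRD; last by rewrite (gt_eqF TR) implybT.
apply: (@le_trans _ _ (`|K| / eta ^+ k * powR T%:R (eta * k%:R))); last first.
  by apply: ler_wpM2r; [exact: powR_ge0|exact: hT0 (ltnW hT)].
apply: (@le_trans _ _ (`|K| * ln T%:R ^+ k)).
  by rewrite ler_wpM2r ?exprn_ge0// ler_norm.
rewrite -mulrA ler_wpM2l// powRrM powR_mulrn ?powR_ge0// -exprVn -exprMn.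
rewrite lerXn2r ?nnegrE//; first by rewrite mulr_ge0 ?invr_ge0 ?powR_ge0 ?ltW.
by rewrite mulrC; exact: ln_le_powR.
Qed.

End asymptotics.

(** * Exponents, constants and thresholds for the two demands *)

Theorem theorem1 (R : realType) (pmin alpha beta La Lb sigma : R) :
  0 < pmin -> pmin < 1 ->
  0 < beta -> beta < alpha -> 0 < La -> 0 < Lb -> 0 < sigma ->
  exists C : R, 0 < C /\
  forall Pi : nat -> policy pmin,
    (exists (C0 : R) (k T0 : nat), forall T : nat, (T0 <= T)%N ->
       (sup_regret sigma alpha La (Pi T) T <=
        (C0 * powR T%:R ((alpha + 1) / (2 * alpha + 1)) * ln (T%:R) ^+ k)%:E)%E) ->
    exists T1 : nat, forall T : nat, (T1 <= T)%N ->
      ((C * powR T%:R ((beta + 1) / (2 * beta + 1)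
          + beta * (alpha - beta)
            / (2 * (2 * beta + 1) ^+ 2 * (2 * alpha + 1))))%:E
       <= sup_regret sigma beta Lb (Pi T) T)%E.
Proof.
move=> pmin0 pmin1 beta0 ab La0 Lb0 sigma0.
have alpha0 : 0 < alpha by exact: lt_trans ab.
set rho := (alpha + 1) / (2 * alpha + 1).
set tau := _ + _ / _.
have a2 : 0 < 2 * alpha + 1 by lra.
have b2 : 0 < 2 * beta + 1 by lra.
have b1 : 0 < beta + 1 by lra.
have rho_half : 1 / 2 < rho by rewrite /rho ltr_pdivlMr//; lra.
have gain : 0 < beta * (alpha - beta) / (2 * (2 * beta + 1) ^+ 2 * (2 * alpha + 1)).
  by rewrite divr_gt0 ?mulr_gt0 ?exprn_gt0// subr_gt0.
have tau_half : 1 - tau < 1 / 2.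
  have : (beta + 1) / (2 * beta + 1) = 1 / 2 + 1 / 2 / (2 * beta + 1).
    by field; rewrite gt_eqF.
  have : 0 < 1 / 2 / (2 * beta + 1) by rewrite divr_gt0.
  by move: gain; rewrite /tau; lra.
have slack : rho * beta / (beta + 1) < 1 - tau.
  rewrite -subr_gt0.
  have -> : 1 - tau - rho * beta / (beta + 1) =
     beta * (alpha - beta) * (3 * beta + 1) /
     (2 * (beta + 1) * (2 * beta + 1) ^+ 2 * (2 * alpha + 1)).
    by rewrite /tau /rho; field; rewrite !gt_eqF.
  rewrite divr_gt0 ?mulr_gt0 ?exprn_gt0 ?subr_gt0//; lra.
(* [s] is the exponent in [u ^+ n = T^(- s)]. Its upper bound makes [T^(1 - s)] exceed [T^tau]; its
   lower bound makes [zeta] positive. *)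
pose s := (rho * beta / (beta + 1) + (1 - tau)) / 2.
have s_tau : s < 1 - tau by rewrite /s; lra.
have s_rho : rho * beta / (beta + 1) < s by rewrite /s; lra.
have rb0 : 0 < rho * beta / (beta + 1).
  by rewrite divr_gt0// mulr_gt0//; lra.
have s0 : 0 < s by lra.
(* Rare visits require about [T^(rho - s)] bins, and bumps of height [T^(- s)] may have frequency
   [T^(s / beta)]. [zeta] is the surplus exponent, of which the width [u = T^(- s / n)] of the
   binned interval uses up [s / n]. *)
pose zeta := s + s / beta - rho.
have zeta0 : 0 < zeta.
  move: s_rho; rewrite ltr_pdivrMr// => h.
  have -> : zeta = (s * (beta + 1) - rho * beta) / beta.
    by rewrite /zeta; field; rewrite gt_eqF.
  by rewrite divr_gt0// subr_gt0.
pose n := (Num.truncn (s / zeta)).+1.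
have nR : 0 < n%:R :> R by rewrite ltr0n.
have sn : s / n%:R < zeta.
  rewrite ltr_pdivrMr// mulrC -ltr_pdivrMr//; exact: truncnS_gt.
(* [x] is the exponent of the number of bins; [y] below is what remains of the surplus. *)
pose x := s / beta - s / n%:R.
have x0 : 0 < x by rewrite /x; move: sn; rewrite /zeta; lra.
pose y := s + x - rho.
have y0 : 0 < y by rewrite /y /x; move: sn; rewrite /zeta; lra.
(* Half of [Lb] is for the base demand, half for the bump. *)
have Lb2 : 0 < Lb / 2 by rewrite divr_gt0.
have [ca ca0 hca] := hoelder_poly (flat n) alpha0 La0 (ltW pmin0).
have [cb cb0 hcb] := hoelder_poly (flat n) beta0 Lb2 (ltW pmin0).
pose c := Num.min ca cb.
have c0 : 0 < c by rewrite lt_min ca0.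
have fa : Defs.hoelder pmin alpha La (base_demand n c).
  by apply: hca; rewrite (ltW c0) ge_min lexx.
have fb : Defs.hoelder pmin beta (Lb / 2) (base_demand n c).
  by apply: hcb; rewrite (ltW c0) ge_min lexx orbT.
pose A := 2 * c * 2 ^+ n / pmin.
have A0 : 0 < A by rewrite divr_gt0// !mulr_gt0// exprn_gt0.
pose w := wdeg beta.
pose B : R := bump_bound w.
have B0 : 0 <= B by exact: bump_bound_ge0.
(* Factor in the number of bins, chosen so that the bump has Hoelder constant at most [Lb / 2]. *)
pose kap := powR (Lb / (4 * (A * B + 1))) beta^-1.
have AB1 : 0 < A * B + 1 by rewrite ltr_wpDl// mulr_ge0// ltW.
have kap0 : 0 < kap by apply: powR_gt0; rewrite divr_gt0// mulr_gt0.
have kapb : 2 * (A * B) * powR kap beta <= Lb / 2.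
  rewrite -powRrM mulVf ?gt_eqF// powRr1; last first.
    by rewrite divr_ge0 ?(ltW Lb0)// mulr_ge0// ltW.
  rewrite (_ : 2 * (A * B) * (Lb / (4 * (A * B + 1))) =
    Lb / 2 * (A * B / (A * B + 1))); last by field; rewrite gt_eqF.
  by rewrite ler_piMr ?(ltW Lb2)// ler_pdivrMr// mul1r lerDl.
exists 1; split=> // Pi [C0 [k [T0 hT0]]].
pose K := 4 * (1 + A ^+ 2 / sigma ^+ 2) * `|C0| / (c * kap).
have sn0 : 0 < s / n%:R by rewrite divr_gt0.
have st0 : 0 < 1 - s - tau by lra.
(* In this order, the thresholds put the bins inside [[pmin, 1]], provide at least one bin, absorb
   the polylogarithm in the information bound, and absorb the constant of the final bound. *)
have [T1 hT1] := powR_unbounded (2 / (1 - pmin)) sn0.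
have [T2 hT2] := powR_unbounded kap^-1 x0.
have [T3 hT3] := polylog_le_powR K k y0.
have [T4 hT4] := powR_unbounded (2 * expR 1 / c) st0.
exists (maxn T0 (maxn T1 (maxn T2 (maxn T3 T4)))).+1 => T hT.
have {hT} [Tpos [TT0 [TT1 [TT2 [TT3 TT4]]]]] : (0 < T)%N /\ (T0 <= T)%N /\
    (T1 <= T)%N /\ (T2 <= T)%N /\ (T3 <= T)%N /\ (T4 <= T)%N.
  have h : (maxn T0 (maxn T1 (maxn T2 (maxn T3 T4))) <= T)%N by exact: ltnW.
  move: h; rewrite !geq_max => /andP[-> /andP[-> /andP[-> /andP[-> ->]]]].
  by rewrite (leq_trans _ hT).
have {}hT0 := hT0 _ TT0; have {}hT1 := hT1 _ TT1; have {}hT2 := hT2 _ TT2.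
have {}hT3 := hT3 _ TT3; have {}hT4 := hT4 _ TT4.
set t : R := T%:R in hT0 hT1 hT2 hT3 hT4 *.
have t0 : 0 < t by rewrite ltr0n.
have t1 : 1 <= t by rewrite ler1n.
have pD p q : powR t (p + q) = powR t p * powR t q.
  by rewrite powRD// (gt_eqF t0) implybT.
have p0 p : 0 < powR t p by exact: powR_gt0.
have pN p : powR t p * powR t (- p) = 1 by rewrite -pD subrr powRr0.
pose u := powR t (- (s / n%:R)).
have u0 : 0 < u by exact: p0.
have un : u ^+ n = powR t (- s).
  by rewrite -powR_mulrn ?(ltW u0)// /u -powRrM mulNr divfK ?gt_eqF.
have uinv : powR t (s / n%:R) * u = 1 by exact: pN.
have u1 : u <= 1.
  by rewrite /u powRN invf_le1// -[leLHS](powRr0 t) ler_powR// ltW.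
have u_le : 2 * u <= 1 - pmin.
  move: hT1; rewrite ler_pdivrMr ?subr_gt0// -(ler_pM2r u0) mulrAC uinv mul1r.
  by [].
pose M := Num.truncn (kap * powR t x).
have kt1 : 1 <= kap * powR t x by rewrite mulrC -ler_pdivrMr// mul1r.
have kt0 : 0 <= kap * powR t x by exact: le_trans kt1.
have MR_le : M%:R <= kap * powR t x by rewrite truncn_le.
have M0 : (0 < M)%N by rewrite truncn_gt0.
have MR : 1 <= M%:R :> R by rewrite ler1n.
have MR_ge : kap * powR t x / 2 <= M%:R.
  have := truncnS_gt (kap * powR t x); rewrite -/M -natr1; lra.
pose H := 2 * c * (2 * u) ^+ n / pmin.
have HE : H = A * powR t (- s).
  by rewrite /H exprMn un /A; ring.
pose r := C0 * powR t rho * ln t ^+ k.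
have hr : (regret sigma (base_demand n c) (Pi T) T <= r%:E)%E.
  by apply: le_trans hT0; apply: ereal_sup_ubound; exists (base_demand n c).
have ln0 : 0 <= ln t ^+ k by rewrite exprn_ge0// ln_ge0.
(* The exponents are [rho - 2 * s] on the left and [x - s = rho - 2 * s + y] on the right; [T^y]
   absorbs constants and logarithms. *)
have info : (t^-1 + H ^+ 2 / sigma ^+ 2) * r <= c * u ^+ n * M%:R / 2.
  pose q := 1 + A ^+ 2 / sigma ^+ 2.
  have q0 : 0 < q by rewrite ltr_wpDr// divr_ge0 ?sqr_ge0.
  have v2 : powR t (- s) ^+ 2 = powR t (- s + - s) by rewrite pD expr2.
  (* Here [tau_half] enters, through [2 * s <= 1]. *)
  have tinv : t^-1 <= powR t (- s) ^+ 2.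
    by rewrite v2 -powR_inv1 ?(ltW t0)// ler_powR//; lra.
  have le_q : t^-1 + H ^+ 2 / sigma ^+ 2 <= q * powR t (- s) ^+ 2.
    by rewrite HE exprMn /q mulrDl mul1r mulrAC lerD2r.
  have lhs0 : 0 <= t^-1 + H ^+ 2 / sigma ^+ 2.
    by rewrite addr_ge0 ?invr_ge0 ?(ltW t0)// divr_ge0 ?sqr_ge0.
  apply: (@le_trans _ _ (q * powR t (- s) ^+ 2 * (`|C0| * powR t rho * ln t ^+ k))).
    apply: (@le_trans _ _ ((t^-1 + H ^+ 2 / sigma ^+ 2) *
        (`|C0| * powR t rho * ln t ^+ k))).
      apply: ler_wpM2l => //; rewrite /r -!mulrA ler_wpM2r ?ler_norm//.
      by rewrite mulr_ge0// ltW.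
    apply: ler_wpM2r => //; rewrite !mulr_ge0//; exact: ltW.
  apply: (@le_trans _ _ (c * u ^+ n * (kap * powR t x / 2) / 2)); last first.
    by rewrite ler_pM2r ?invr_gt0// ler_pM2l// mulr_gt0// exprn_gt0.
  rewrite un.
  have xE : powR t x = powR t y * powR t rho * powR t (- s).
    by rewrite -!pD; congr powR; rewrite /y; ring.
  have ck : 0 < c * kap / 4 by rewrite !mulr_gt0// invr_gt0.
  have := ler_wpM2l (ltW ck) hT3.
  have -> : c * kap / 4 * (K * ln t ^+ k) = q * `|C0| * ln t ^+ k.
    by rewrite /K -/q; field; rewrite !gt_eqF.
  have V0 : 0 <= powR t rho * powR t (- s) ^+ 2 by rewrite mulr_ge0 ?sqr_ge0// ltW.
  move=> /(ler_wpM2r V0); rewrite xE.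
  set U := powR t (- s); set Y := powR t y; set P := powR t rho.
  by set L := ln t ^+ k => h; lra.
have [j jM hj] := @regret_tradeoff R pmin sigma pmin0 pmin1 sigma0 n M w c u
  erefl M0 c0 u0 u_le (Pi T) T r Tpos hr info.
have fj : Defs.hoelder pmin beta Lb (bumped_demand pmin n M w c u j).
  have -> : Lb = Lb / 2 + Lb / 2 by field.
  apply: hoelderD => //; apply: hoelder_bump => //.
  - rewrite ler_pdivlMr// mul1r; exact: le_trans u1 MR.
  - by rewrite -/H HE mulr_ge0 ?(ltW A0)// ltW.
  - rewrite -/H HE; apply: le_trans kapb.
    (* The frequency [M / u] is at most [kap * T^(s / beta)]; its power [beta] balances the height
       [A * T^(- s)]. *)
    have Mb : powR (M%:R / u) beta <= powR kap beta * powR t s.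
      have -> : powR kap beta * powR t s =
          powR (kap * powR t (s / beta)) beta.
        by rewrite powRM ?(ltW kap0) ?powR_ge0// -powRrM divfK ?gt_eqF.
      apply: ge0_ler_powR; first exact: ltW.
      + by rewrite nnegrE divr_ge0 ?ler0n ?(ltW u0).
      + by rewrite nnegrE mulr_ge0 ?powR_ge0 ?(ltW kap0).
      rewrite ler_pdivrMr// -mulrA /u -pD; exact: MR_le.
    have AB0 : 0 <= 2 * (A * B * powR t (- s)).
      by rewrite mulr_ge0// mulr_ge0 ?powR_ge0// mulr_ge0// ltW.
    have := ler_wpM2l AB0 Mb.
    have := pN s; set U := powR t (- s); set V := powR t s => VU.
    rewrite (_ : 2 * (A * B * U) * (powR kap beta * V) =
       2 * (A * B) * powR kap beta * (V * U)); last by ring.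
    rewrite VU mulr1; apply: le_trans.
    by rewrite le_eqVlt; apply/orP; left; apply/eqP; rewrite /B /w; ring.
(* The bound [T * D / (2 * expR 1)] is of order [T^(1 - s)], and the excess [T^(1 - s - tau)] beats
   the constant. *)
apply: (@le_trans _ _ (regret sigma (bumped_demand pmin n M w c u j) (Pi T) T)).
  apply: le_trans hj; rewrite lee_fin mul1r un -/t.
  have e1 : 0 < expR (1 : R) by exact: expR_gt0.
  have tE : t * powR t (- s) = powR t (1 - s - tau) * powR t tau.
    by rewrite -{1}[t](powRr1 (ltW t0)) -!pD; congr powR; ring.
  have -> : t * (c * powR t (- s)) = c * (powR t (1 - s - tau) * powR t tau).
    by rewrite -tE; ring.
  rewrite ler_pdivlMr ?mulr_gt0//.
  move: hT4; rewrite ler_pdivrMr// => /(ler_wpM2r (ltW (p0 tau))); lra.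
by apply: ereal_sup_ubound; exists (bumped_demand pmin n M w c u j).
Qed.
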